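(* Let $D\ge 2$ be a constant and $d,n,m\in\mathbb{N}$. Let $\nu_N$ be the distribution of the system of degree-$D$ $n$-variate polynomial equations $\{g_i(x)=b_i\}_{i\in[m]}$ where $g_i(x)=\langle G_i,x^{\otimes D}\rangle$ for a tensor $G_i\in(\mathbb{R}^n)^{\otimes D}$ whose entries are independent standard Gaussians, and $b_1,\dots,b_m$ are independent standard Gaussians (independent of the $G_i$). Then there is a constant $c_D>0$ depending only on $D$ such that for every $d\le 2n/D$, whenever $m\le c_D\,n^D/d^{D-1}$, there exists a probability distribution $\nu_P$ on such systems (i.e. on $(G_1,\dots,G_m,b_1,\dots,b_m)$) that is supported on systems admitting a real solution, such that degree-$d$ polynomials fail to $(1/2)$-distinguish between $\nu_N$ and $\nu_P$.
   Context: For distributions $\nu_N,\nu_P$ on $\mathbb{R}^K$ and $\delta>0$, degree-$d$ polynomials succeed in $(1-\delta)$-distinguishing $\nu_N$ and $\nu_P$ if there is a polynomial $f:\mathbb{R}^K\to\mathbb{R}$ of degree at most $d$ with $\mathbb{E}_{\nu_N}[f^2]=1$ and $\mathbb{E}_{\nu_P}[f]\ge 1/\delta$; they fail to $(1-\delta)$-distinguish if no such $f$ exists. Here the input coordinates are the entries of $G_1,\dots,G_m$ and $b_1,\dots,b_m$. *)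

(* Defs.v *)
From HB Require Import structures.
From mathcomp Require Import all_boot all_order all_algebra.
(* Only the structures on [mpoly] are imported: its notations clash with those
   of the analysis library. *)
From mathcomp Require mpoly.
From mathcomp Require Import all_classical all_reals all_analysis.
Import (canonicals, coercions) mpoly.

Set Implicit Arguments.
Unset Strict Implicit.
Unset Printing Implicit Defensive.

Import Order.TTheory GRing.Theory Num.Theory.
Import numFieldNormedType.Exports.

Local Open Scope classical_set_scope.
Local Open Scope ring_scope.

(* R^K with its product (= Borel) sigma-algebra *)
Notation vect R K := (K.-tuple (measurableTypeR R)).

Section GaussianVector.
Variable R : realType.

Definition vcons K (xv : measurableTypeR R * vect R K) : vect R K.+1 :=
  [tuple of xv.1 :: xv.2].

Lemma measurable_vcons K : measurable_fun [set: measurableTypeR R * vect R K]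
  (@vcons K).
Proof. exact: measurable_cons. Qed.

HB.instance Definition _ K :=
  isMeasurableFun.Build _ _ _ _ (@vcons K) (@measurable_vcons K).

Fixpoint std_gaussian K : probability (vect R K) R :=
  if K is K'.+1 then
    distribution (normal_prob 0 1 \x std_gaussian K')%E (@vcons K')
  else dirac (nil_tuple (measurableTypeR R)).

(* The coordinates are independent standard Gaussians. *)
Lemma std_gaussian_box K (A : 'I_K -> set (measurableTypeR R)) :
  (forall i, measurable (A i)) ->
  (std_gaussian K [set v | forall i, tnth v i \in A i]
   = \prod_(i < K) normal_prob 0 1 (A i))%E.
Proof.
elim: K A => [|K IH] A mA /=.
  rewrite big_ord0 /dirac indicE mem_set //=.
  by case.
rewrite /distribution /pushforward.
have -> : @vcons K @^-1` [set v | forall i, tnth v i \in A i]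
    = A ord0 `*` [set v | forall i, tnth v i \in A (lift ord0 i)].
  apply/seteqP; split => -[x v] /=.
    move=> h; split; first by have /set_mem := h ord0.
    by move=> i; have := h (lift ord0 i); rewrite tnthS.
  move=> [/mem_set h0 h] i; case: (unliftP ord0 i) => [j ->|->].
    by rewrite tnthS; exact: h.
  by rewrite tnth0.
rewrite big_ord_recl -IH //; apply: product_measure1E => //.
rewrite (_ : [set v | _] = \bigcap_(i in [set: 'I_K])
    ((@tnth K (measurableTypeR R) ^~ i) @^-1` A (lift ord0 i))).
  apply: fin_bigcap_measurable => // i _; rewrite -[X in measurable X]setTI.
  exact: measurable_tnth.
apply/seteqP; split => v /= h i; first by move=> _; exact/set_mem/h.
exact/mem_set/h.
Qed.

End GaussianVector.

Section LowDegree.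
Variables (R : realType) (K : nat).
Implicit Types (nu : probability (vect R K) R) (f : mpoly.mpoly K R).

Definition poly_fun f (v : vect R K) : R := mpoly.meval (tnth v) f.

Definition deg_le d f := (mpoly.msize f <= d.+1)%N.

(* Degree-d polynomials (1 - delta)-distinguish nuN and nuP. *)
Definition distinguishes d (delta : R) nuN nuP := exists f,
  [/\ deg_le d f,
      ('E_nuN[fun v => (poly_fun f v ^+ 2)%R] = 1)%E
    & (delta^-1%:E <= 'E_nuP[poly_fun f])%E].

Definition fails_to_distinguish d delta nuN nuP :=
  ~ distinguishes d delta nuN nuP.

(* The integral of a function whose positive and negative parts both have an
   infinite integral is -oo by convention, so that [fails_to_distinguish] is
   meaningful only for distributions nuP with finite moments up to order d. *)
Definition finite_moments d nu := forall f, deg_le d f ->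
  nu.-integrable [set: vect R K] (EFin \o poly_fun f).

End LowDegree.

(* The coordinates of a system of m equations of degree D in n variables:
   [inl (i, a)] is the entry of index a of the tensor G_i, and [inr i] is the
   right-hand side b_i. *)
Notation coords D n m := ('I_m * D.-tuple 'I_n + 'I_m)%type.

Notation system R D n m := (vect R #|{: coords D n m}|).

Section Systems.
Variables (R : realType) (D n m : nat).
Implicit Types (s : system R D n m) (i : 'I_m) (x : 'rV[R]_n).

Definition coef s i (a : D.-tuple 'I_n) : R := tnth s (enum_rank (inl (i, a))).

Definition rhs s i : R := tnth s (enum_rank (inr i)).

(* <G_i, x^{\otimes D}> *)
Definition lhs s i x : R :=
  \sum_(a : D.-tuple 'I_n) coef s i a * \prod_(k < D) x 0 (tnth a k).

Definition solvable s := exists x, forall i, lhs s i x = rhs s i.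

Definition random_system : probability (system R D n m) R :=
  std_gaussian R #|{: coords D n m}|.

End Systems.

(* Main.v *)
(** A planted system is obtained from a Gaussian one by projecting, for every
    [i], the vector [(G_i, b_i)] onto the orthogonal complement of
    [(x^{\otimes D}, -1)], where [x] is uniform in [{-t, t}^n]: then [x] is a
    solution.  Let [w_x] be the normalized vector, and [w_(x, i)] its copy in the
    coordinates of the [i]-th equation.  By Gaussian integration by
    parts, the expectation of a polynomial [f] after the projection is
    [E[f L_x]], where [L_x] is the truncation of
    [exp (- 1/2 \sum_i a(w_(x, i))^2) 1] and [a(v) = <v, .> - d/dv] is the
    creation operator, the adjoint of [d/dv].  By Cauchy-Schwarz, the advantage
    is at most the norm of the average of the [L_x], and the commutation
    relations of [a] and [d/dv] give
    [E[L_x L_y] = \sum_(k <= d/2) 'C(m/2 + k - 1, k) <w_x, w_y>^(2 k)].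
    For [t] large, [<w_x, w_y>] is close to [(<x, y> / (t^2 n))^D], whose
    moments are bounded by those of a Gaussian (Khintchine); the series is
    dominated by a geometric one as soon as [m d^(D-1)] is at most a small
    multiple of [n^D], [D k <= n] keeping the Gaussian moments below [1]. *)
Require Import Defs.
From HB Require Import structures.
From mathcomp Require Import all_boot all_order all_algebra.
From mathcomp Require mpoly.
From mathcomp Require Import all_classical all_reals all_analysis.
From mathcomp Require Import measurable_realfun.
From mathcomp Require Import ring lra.
Import (canonicals, coercions) mpoly.

Set Implicit Arguments.
Unset Strict Implicit.
Unset Printing Implicit Defensive.

Import Order.TTheory GRing.Theory Num.Theory.
Import numFieldNormedType.Exports.

Local Open Scope classical_set_scope.
Local Open Scope ring_scope.

(** * Gaussian moments *)

(** The exponent x^2/4 is half that of the Gaussian density, so a power times the density keeps a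
    Gaussian decay. The bound combines |x|^p <= 1 + x^(2p) with one term of the exponential
    series. *)
Lemma expR_dominates_pow (R : realType) (p : nat) :
  exists2 C : R, 0 <= C & forall x, `|x| ^+ p <= C * expR (x ^+ 2 / 4).
Proof.
exists (1 + 4 ^+ p * p`!%:R) => [|x]; first by rewrite addr_ge0// mulr_ge0// exprn_ge0.
have hx : `|x| ^+ p <= 1 + x ^+ 2 ^+ p.
  rewrite -[x ^+ 2]real_normK ?num_real// -exprM mulnC exprM.
  have : 0 <= `|x| ^+ p by rewrite exprn_ge0.
  move: (`|x| ^+ p) => y y0; nra.
have u0 : 0 <= x ^+ 2 / 4 by rewrite divr_ge0 ?sqr_ge0.
have e1 : 1 <= expR (x ^+ 2 / 4) by apply: le_trans (expR_ge1Dx _); rewrite lerDl.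
apply: (le_trans hx); rewrite mulrDl mul1r; apply: lerD => //.
have -> : x ^+ 2 ^+ p = 4 ^+ p * (x ^+ 2 / 4) ^+ p.
  by rewrite -exprMn; congr (_ ^+ _); lra.
rewrite -mulrA ler_wpM2l ?exprn_ge0//.
case: p {hx} => [|p]; first by rewrite expr0 fact0 mul1r.
have := @expR_ge1Dxn R _ p u0.
set a := _ ^+ _; set f := p.+1`!%:R => h.
have f0 : 0 < f :> R by rewrite ltr0n fact_gt0.
have : a / f <= expR (x ^+ 2 / 4) by apply: le_trans h; rewrite lerDr.
by rewrite ler_pdivrMr// mulrC.
Qed.

Section NormalMoments.
Variable R : realType.
Local Notation mu := (@lebesgue_measure R).
Local Notation gauss := (@normal_prob R 0 1).
Local Notation pdf := (@normal_pdf R 0 1).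

(** The Radon-Nikodym derivative of the normal law agrees almost everywhere with [pdf], both having
    the same integral over every measurable set. *)
Lemma ge0_integral_normal_prob (f : R -> \bar R) :
  (forall x, 0 <= f x)%E -> measurable_fun [set: R] f ->
  (\int[gauss]_x f x = \int[mu]_x (f x * (pdf x)%:E))%E.
Proof.
move=> f0 mf.
have dom : gauss `<< mu := normal_prob_dominates 0 1.
rewrite -(Radon_Nikodym_SigmaFinite.change_of_variables dom f0 measurableT mf).
apply: ae_eq_integral => //.
- apply: emeasurable_funM => //; apply: (measurable_int mu).
  exact: Radon_Nikodym_SigmaFinite.f_integrable.
- by apply: emeasurable_funM => //; apply/measurable_EFinP;
    exact: measurable_normal_pdf.
- apply: ae_eqe_mul2l => /=.
  apply: integral_ae_eq => //=.
  + exact: Radon_Nikodym_SigmaFinite.f_integrable.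
  + by apply/measurable_EFinP; exact: measurable_normal_pdf.
  + by move=> E _ mE; rewrite -Radon_Nikodym_SigmaFinite.f_integral.
Qed.

Lemma integrable_normal_prob (f : R -> \bar R) : measurable_fun [set: measurableTypeR
    R] f ->
  mu.-integrable [set: R] (fun x => f x * (pdf x)%:E)%E ->
  gauss.-integrable [set: R] f.
Proof.
move=> mf /integrableP[_ fi]; apply/integrableP; split => //.
rewrite ge0_integral_normal_prob//; last exact: measurableT_comp.
apply: le_lt_trans fi; rewrite le_eqVlt; apply/orP; left; apply/eqP.
apply: eq_integral => x _.
by rewrite /= abseM (@gee0_abs _ (pdf x)%:E)// lee_fin normal_pdf_ge0.
Qed.

Lemma integral_normal_prob (f : R -> \bar R) : measurable_fun [set: measurableTypeR
    R] f ->
  (\int[gauss]_x f x = \int[mu]_x (f x * (pdf x)%:E))%E.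
Proof.
move=> mf; rewrite integralE [RHS]integralE.
have p0 x : (0 <= (pdf x)%:E)%E by rewrite lee_fin normal_pdf_ge0.
rewrite !ge0_integral_normal_prob//; last 2 first.
- exact: measurable_funeneg.
- exact: measurable_funepos.
congr (_ - _)%E; apply: eq_integral => x _.
  by rewrite !funeposE maxe_pMl// ?mul0e.
by rewrite !funenegE maxe_pMl// ?mul0e ?muleN ?mulNe.
Qed.

Lemma std_normal_pdfE x : pdf x = normal_peak 1 * expR (- (x ^+ 2 / 2)).
Proof.
by rewrite normal_pdfE ?oner_neq0// /normal_fun subr0 expr1n mulr2n mulNr.
Qed.

Lemma pow_pdf_le (p : nat) : exists2 C : R, 0 <= C &
  forall x, `|x ^+ p * pdf x| <= C * normal_pdf 0 2 x.
Proof.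
have [C C0 hC] := expR_dominates_pow R p.
have n2 : (2 : R) != 0 by rewrite pnatr_eq0.
have pk : 0 < normal_peak (2 : R) by rewrite normal_peak_gt0.
exists (C * normal_peak 1 / normal_peak 2).
  by rewrite divr_ge0 ?mulr_ge0// ?normal_peak_ge0.
move=> x; rewrite normrM normrX [X in _ * X]ger0_norm ?normal_pdf_ge0//.
rewrite std_normal_pdfE normal_pdfE// /normal_fun subr0.
set e := expR (- (_ / 2)); set g := expR _.
suff h : `|x| ^+ p * e <= C * g.
  have -> : C * normal_peak 1 / normal_peak 2 * (normal_peak 2 * g) =
      normal_peak 1 * (C * g) by field; rewrite gt_eqF.
  by rewrite mulrCA ler_wpM2l ?normal_peak_ge0.
apply: (@le_trans _ _ (C * expR (x ^+ 2 / 4) * e)).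
  by rewrite ler_wpM2r ?expR_ge0.
(* The exponents compared are -x^2/4 and -x^2/8, since [normal_pdf 0 2] has standard deviation 2. *)
rewrite -mulrA ler_wpM2l// -expRD ler_expR.
have := sqr_ge0 x; move: (x ^+ 2) => y y0; lra.
Qed.

Lemma pow_pdf_bounded (p : nat) : exists2 C : R, 0 <= C &
  forall x, `|x ^+ p * pdf x| <= C.
Proof.
have [C C0 hC] := pow_pdf_le p; exists (C * normal_peak 2).
  by rewrite mulr_ge0 ?normal_peak_ge0.
move=> x; apply: le_trans (hC x) _; by rewrite ler_wpM2l// normal_pdf_ub.
Qed.

Lemma measurable_pow_pdf (p : nat) :
  measurable_fun [set: R] (fun x : R => x ^+ p * pdf x).
Proof. by apply: measurable_funM => //; exact: measurable_normal_pdf. Qed.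

Lemma integrable_pow_pdf (p : nat) :
  mu.-integrable [set: R] (fun x => (x ^+ p * pdf x)%:E).
Proof.
have [C C0 hC] := pow_pdf_le p.
apply: (@le_integrable _ _ _ mu _ measurableT _
  (fun x => C%:E * (normal_pdf 0 2 x)%:E)%E).
- by apply/measurable_EFinP; exact: measurable_pow_pdf.
- move=> x _; rewrite -EFinM !abse_EFin lee_fin [leRHS]ger0_norm ?hC//.
  by rewrite mulr_ge0// normal_pdf_ge0.
- by apply: integrableZl => //; exact: integrable_normal_pdf.
Qed.

Lemma is_derive_pow_pdf (p : nat) (x : R) :
  is_derive x 1 (fun x : R => x ^+ p * pdf x)
    (p%:R * (x ^+ p.-1 * pdf x) - x ^+ p.+1 * pdf x).
Proof.
rewrite (_ : (fun x => _) = ((id : R -> R) ^+ p) *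
    (normal_peak 1 \*: (expR \o (- (2^-1 \*: ((id : R -> R) ^+ 2)))))); last first.
  apply/funext => y; rewrite std_normal_pdfE !fctE /=.
  by rewrite (mulrC (y ^+ 2)).
apply: is_derive_eq; rewrite std_normal_pdfE !fctE /= !/(_ *: _) /= !mulr1 expr1.
rewrite (mulrC (x ^+ 2)) (exprS x p).
set e := expR _; set q := x ^+ p; set r := x ^+ p.-1.
by field.
Unshelve. all: by [].
Qed.

(** Boundedness at exponent p+1 gives a decay in 1/n at exponent p. Only n and -n matter: they are
    the endpoints of the intervals exhausting the line. *)
Lemma pow_pdf_cvg0 (p : nat) :
  (n%:R ^+ p * pdf n%:R @[n --> \oo] --> (0 : R)) /\
  ((- n%:R) ^+ p * pdf (- n%:R) @[n --> \oo] --> (0 : R)).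
Proof.
have [C C0 hC] := pow_pdf_bounded p.+1.
have H (s : R) : `|s| = 1 ->
    (s * n%:R) ^+ p * pdf (s * n%:R) @[n --> \oo] --> (0 : R).
  move=> s1; apply/cvgr0Pnorm_le => e e0; near=> n.
  have n0 : 0 < n%:R :> R by rewrite ltr0n; near: n; exists 1%N.
  have := hC (s * n%:R); rewrite exprS -mulrA normrM normrM s1 mul1r normr_nat.
  move=> h; rewrite -(ler_pM2l n0); apply: (le_trans h).
  rewrite -ler_pdivrMr//; near: n; exact: nbhs_infty_ger.
split; last first.
  by under eq_cvg do rewrite -mulN1r; apply: H; rewrite normrN1.
by under eq_cvg do rewrite -[X in X ^+ _]mul1r -[X in pdf X]mul1r; apply: H;
  rewrite normr1.
Unshelve. all: by end_near.
Qed.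

Lemma cvg_integral_sym_itv (g : R -> R) : mu.-integrable [set: R] (EFin \o g) ->
  (\int[mu]_(x in `[(- n%:R)%R, n%:R]) (g x)%:E)%E @[n --> \oo] -->
  (\int[mu]_x (g x)%:E)%E.
Proof.
move=> ig.
have mg := measurable_int _ ig.
pose f_ n := ((EFin \o g) \_ `[(- n%:R)%R, n%:R])%E.
have := @dominated_convergence _ _ _ mu _ measurableT f_ (EFin \o g) (abse \o (EFin
    \o g)).
case.
- by move=> n; apply/(measurable_restrictT _ _).1 => //; exact: measurable_funTS.
- exact: mg.
- apply: aeW => x _; apply: cvg_near_cst; near=> n; rewrite /f_ patchE ifT//.
  rewrite inE/= in_itv/= -ler_norml; near: n; exact: nbhs_infty_ger.
- exact: integrable_abse.
- apply: aeW => x n _; rewrite /f_ patchE; case: ifPn => //= _.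
  by rewrite /point/= normr0 lee_fin.
move=> _ _; apply: cvg_trans; apply: near_eq_cvg; apply: nearW => n.
by rewrite /= [RHS]integral_mkcond.
Unshelve. all: by end_near.
Qed.

(** The integrand is the derivative of x^p [pdf x]: the fundamental theorem of calculus on [-n, n]
    leaves boundary terms that tend to 0. *)
Lemma integral_deriv_pow_pdf (p : nat) :
  (\int[mu]_x (p%:R * (x ^+ p.-1 * pdf x) - x ^+ p.+1 * pdf x)%:E = 0)%E.
Proof.
have ig : mu.-integrable [set: R]
   (EFin \o (fun x => p%:R * (x ^+ p.-1 * pdf x) - x ^+ p.+1 * pdf x)).
  rewrite (_ : _ \o _ = ((fun x => p%:R%:E * (x ^+ p.-1 * pdf x)%:E)
     \- (fun x => (x ^+ p.+1 * pdf x)%:E))%E)//.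
  apply: integrableB => //; last exact: integrable_pow_pdf.
  by apply: integrableZl => //; exact: integrable_pow_pdf.
apply: (cvg_unique _ (cvg_integral_sym_itv ig)) => //.
have cP k : continuous (fun x : R => x ^+ k * pdf x).
  move=> x; apply: cvgM; first exact: exprn_continuous.
  by apply: continuous_normal_pdf; rewrite oner_eq0.
have -> : 0%E = (0 - 0 : R)%:E by rewrite subr0.
have [h1 h2] := pow_pdf_cvg0 p.
have h : (n%:R ^+ p * pdf n%:R - (- n%:R) ^+ p * pdf (- n%:R))%:E
    @[n --> \oo] --> (0 - 0 : R)%:E.
  by apply: cvg_EFin; [exact: nearW | exact: cvgB h1 h2].
apply: cvg_trans h; apply: near_eq_cvg; near=> n.
have n0 : 0 < n%:R :> R by rewrite ltr0n; near: n; exists 1%N.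
rewrite (@continuous_FTC2 _ _ (fun x => x ^+ p * pdf x))//.
- by lra.
- apply: continuous_subspaceT => x; apply: cvgB; last exact: cP.
  by apply: cvgM; [exact: cvg_cst | exact: cP].
- split.
  + by move=> x _; apply: ex_derive; exact: is_derive_pow_pdf.
  + by apply: cvg_at_right_filter; exact: cP.
  + by apply: cvg_at_left_filter; exact: cP.
- by move=> x _; rewrite derive1E; apply: derive_val; exact: is_derive_pow_pdf.
Unshelve. all: by end_near.
Qed.

Lemma integrable_normal_pow (p : nat) :
  gauss.-integrable [set: R] (fun x => (x ^+ p)%:E).
Proof.
apply: integrable_normal_prob; last exact: integrable_pow_pdf.
by apply/measurable_EFinP.
Qed.

(** Integration by parts in one variable. At p = 0 the factor p makes the truncated predecessor
    harmless, and the mean is 0. *)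
Lemma integral_normal_powS (p : nat) :
  (\int[gauss]_x (x ^+ p.+1)%:E = p%:R%:E * \int[gauss]_x (x ^+ p.-1)%:E)%E.
Proof.
rewrite !integral_normal_prob; [|exact/measurable_EFinP..].
have := integral_deriv_pow_pdf p.
under eq_integral do rewrite EFinB EFinM.
rewrite integralB//; last exact: integrable_pow_pdf.
  rewrite integralZl//; last exact: integrable_pow_pdf.
  have := integrable_fin_num measurableT (integrable_pow_pdf p.+1).
  have := integrable_fin_num measurableT (integrable_pow_pdf p.-1).
  by move=> /fineK <- /fineK <-; rewrite -!EFinM -EFinB => -[] /subr0_eq ->.
by apply: integrableZl => //; exact: integrable_pow_pdf.
Qed.

End NormalMoments.

(** * Integrals of separated products *)

Section ProductIntegral.
Context d1 d2 (T1 : measurableType d1) (T2 : measurableType d2) (R : realType).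
Variables (m1 : probability T1 R) (m2 : probability T2 R).
Variables (f : T1 -> R) (g : T2 -> R).
Hypothesis intf : m1.-integrable [set: T1] (EFin \o f).
Hypothesis intg : m2.-integrable [set: T2] (EFin \o g).

Lemma integrable_prod_mul :
  (m1 \x m2)%E.-integrable [set: T1 * T2] (EFin \o (fun z => f z.1 * g z.2)).
Proof.
have mf : measurable_fun [set: T1] f by apply/measurable_EFinP;
    exact: measurable_int intf.
have mg : measurable_fun [set: T2] g by apply/measurable_EFinP;
    exact: measurable_int intg.
apply/integrable12ltyP => /=.
  apply/measurable_EFinP; apply: measurable_funM.
    exact: (measurableT_comp mf measurable_fst).
  exact: (measurableT_comp mg measurable_snd).
have fg := integrable_fin_num measurableT (integrable_abse intg).
rewrite (_ : (\int[m1]_x _)%E =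
    (\int[m1]_x (`|(EFin \o f) x| * \int[m2]_y `|(EFin \o g) y|))%E).
  rewrite -(fineK fg) ge0_integralZr//.
  - apply: lte_mul_pinfty => //.
    + exact: integral_ge0.
    + exact/(integrable_fin_num measurableT)/integrable_abse.
    + by rewrite ltry.
  - by apply: measurableT_comp => //; exact/measurable_EFinP.
  - by rewrite lee_fin; apply: fine_ge0; apply: integral_ge0 => x _; exact: abse_ge0.
apply: eq_integral => x _; rewrite -ge0_integralZl//.
  by apply: eq_integral => y _; rewrite /= normrM EFinM.
by apply: measurableT_comp => //; exact/measurable_EFinP.
Qed.

Lemma integral_prod_mul :
  (\int[m1 \x m2]_z (f z.1 * g z.2)%:E =
   \int[m1]_x (f x)%:E * \int[m2]_y (g y)%:E)%E.
Proof.
rewrite -(@integral12_prod_meas1 _ _ _ _ _ m1 m2 _ integrable_prod_mul)/=.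
rewrite /fubini_F /=.
have /fineK fg := integrable_fin_num measurableT intg.
rewrite -fg muleC -integralZl//.
apply: eq_integral => x _; rewrite fg muleC -integralZl//.
Qed.
End ProductIntegral.

(** * Moments of the Gaussian vector *)

Section GaussianMonomials.
Variable R : realType.
Local Notation gauss := (@normal_prob R 0 1).

Definition normal_moment p : R := fine (\int[gauss]_x (x ^+ p)%:E)%E.

Lemma normal_moment0 : normal_moment 0 = 1.
Proof.
rewrite /normal_moment; under eq_integral do rewrite expr0.
rewrite integral_cst// mul1e [X in fine X](_ : _ = 1%E)//; exact: probability_setT.
Qed.

Lemma normal_momentS p : normal_moment p.+1 = p%:R * normal_moment p.-1.
Proof.
rewrite /normal_moment integral_normal_powS fineM//.
exact: (integrable_fin_num measurableT (integrable_normal_pow _ _)).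
Qed.

Definition monomial_fun K (a : 'I_K -> nat) (v : vect R K) : R :=
  \prod_(i < K) tnth v i ^+ a i.

(** Induction on K: pulled back along [vcons], a monomial separates into a power of the head and a
    monomial of the tail. Integrability is carried along because Fubini needs it. *)
Lemma integral_std_gaussian_monomial K (a : 'I_K -> nat) :
  (std_gaussian R K).-integrable [set: vect R K] (EFin \o monomial_fun a) /\
  (\int[std_gaussian R K]_v (monomial_fun a v)%:E =
   (\prod_(i < K) normal_moment (a i))%:E)%E.
Proof.
have mm k (b : 'I_k -> nat) : measurable_fun [set: vect R k] (EFin \o monomial_fun b).
  apply/measurable_EFinP; apply: measurable_prod => i _.
  by apply: measurable_funX; exact: measurable_tnth.
elim: K a => [|K IH] a.
  have E : (EFin \o monomial_fun a) = cst 1%E.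
    by apply/funext => v; rewrite /= /monomial_fun big_ord0.
  split; first by rewrite E; exact: finite_measure_integrable_cst.
  rewrite -[LHS]/(\int[_]_v (EFin \o monomial_fun a) v)%E E.
  rewrite integral_cst// mul1e big_ord0; exact: probability_setT.
have [i1 e1] := IH (a \o lift ord0).
have E : (EFin \o monomial_fun a) \o @vcons R K =
   EFin \o (fun z => z.1 ^+ a ord0 * monomial_fun (a \o lift ord0) z.2).
  apply/funext => -[x v] /=; rewrite /monomial_fun big_ord_recl tnth0.
  by congr (_ * _)%:E; apply: eq_bigr => i _; rewrite tnthS.
have ip := integrable_prod_mul (integrable_normal_pow R (a ord0)) i1.
have ip' : (normal_prob 0 1 \x std_gaussian R K)%E.-integrable
    [set: measurableTypeR R * vect R K] ((EFin \o monomial_fun a) \o @vcons R K).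
  by rewrite E.
split.
  exact: (integrable_pushforward (@measurable_vcons R K) (mm _ a) ip').
transitivity (\int[normal_prob 0 1 \x std_gaussian R K]_z
    ((EFin \o monomial_fun a) \o @vcons R K) z)%E.
  exact: (integral_pushforward (@measurable_vcons R K) (mm _ a) ip').
rewrite E /=.
rewrite (integral_prod_mul (integrable_normal_pow R (a ord0)) i1).
rewrite e1 big_ord_recl EFinM fineK//.
exact: (integrable_fin_num measurableT (integrable_normal_pow _ _)).
Qed.
End GaussianMonomials.

(** * Gaussian expectation of polynomials *)

Local Notation "''X_' i" := (mpoly.mpolyX _ (mpoly.mnm1 i))
  (at level 8, i at level 2, format "''X_' i") : ring_scope.

Local Arguments mpoly.mderiv : simpl never.

Section GaussianExpectation.
Variables (R : realType) (K : nat).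
Implicit Types (p q : mpoly.mpoly K R) (m : mpoly.multinom K).

(** Polynomials being integrable, [fine] loses nothing, and the expectation becomes a linear
    functional on the polynomial algebra. *)
Definition gauss_exp p : R := fine ('E_(std_gaussian R K)[poly_fun p])%E.

Lemma poly_funE p (v : vect R K) :
  poly_fun p v = \sum_(m <- mpoly.msupp p) mpoly.mcoeff m p * monomial_fun m v.
Proof. exact: mpoly.mevalE. Qed.

Lemma integrable_poly_fun p :
  (std_gaussian R K).-integrable [set: vect R K] (EFin \o poly_fun p).
Proof.
have -> : EFin \o poly_fun p = (fun v : vect R K => \sum_(m <- mpoly.msupp p)
    ((mpoly.mcoeff m p)%:E * (monomial_fun m v)%:E))%E.
  by apply/funext => v; rewrite /= poly_funE -sumEFin.
apply: integrable_sum => // m _; apply: integrableZl => //.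
exact: (@integral_std_gaussian_monomial R K m).1.
Qed.

Lemma expectation_poly_fun p :
  ('E_(std_gaussian R K)[poly_fun p] = (gauss_exp p)%:E)%E.
Proof.
rewrite /gauss_exp fineK// unlock.
exact: (integrable_fin_num measurableT (integrable_poly_fun p)).
Qed.

Lemma gauss_exp_is_linear : linear_for *%R gauss_exp.
Proof.
move=> a p q; apply: EFin_inj.
rewrite EFinD EFinM -!expectation_poly_fun !unlock.
rewrite -integralZl//; last exact: integrable_poly_fun.
rewrite -integralD//; [|by apply: integrableZl => //; exact: integrable_poly_fun
                       |exact: integrable_poly_fun].
by apply: eq_integral => v _; rewrite /= /poly_fun mpoly.mevalD mpoly.mevalZ.
Qed.

HB.instance Definition _ :=
  GRing.isLinear.Build R (mpoly.mpoly K R) R *%R gauss_exp gauss_exp_is_linear.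

Lemma gauss_expX m :
  gauss_exp (mpoly.mpolyX R m) = \prod_(i < K) normal_moment R (m i).
Proof.
apply: EFin_inj; rewrite -expectation_poly_fun unlock.
rewrite -(@integral_std_gaussian_monomial R K m).2.
by apply: eq_integral => v _; rewrite /= /poly_fun mpoly.mevalX.
Qed.

Lemma gauss_exp1 : gauss_exp 1 = 1.
Proof.
rewrite -mpoly.mpolyX0 gauss_expX big1// => i _.
by rewrite mpoly.mnm0E normal_moment0.
Qed.

Lemma gauss_exp_sqr_ge0 p : 0 <= gauss_exp (p ^+ 2).
Proof.
rewrite -lee_fin -expectation_poly_fun unlock; apply: integral_ge0 => v _.
by rewrite lee_fin /poly_fun expr2 mpoly.mevalM -expr2 sqr_ge0.
Qed.

(** By linearity it suffices to treat monomials; there only the j-th factor changes, following the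
    moment recursion. *)
Lemma gauss_exp_ibp j p : gauss_exp ('X_j * p) = gauss_exp (mpoly.mderiv j p).
Proof.
rewrite [p]mpoly.mpolyE mulr_sumr [mpoly.mderiv j _]linear_sum !linear_sum;
    apply: eq_bigr => m _.
rewrite -scalerAr !linearZ/=; congr (_ * _).
rewrite -mpoly.mpolyXD mpoly.mderivX linearZ/= !gauss_expX.
rewrite (bigD1 j)//= [in RHS](bigD1 j)//= mulrA; congr (_ * _); last first.
  apply: eq_bigr => i ij; rewrite mpoly.mnmDE mpoly.mnmBE mpoly.mnm1E.
  by rewrite eq_sym (negbTE ij) subn0.
by rewrite mpoly.mnmDE mpoly.mnmBE mpoly.mnm1E eqxx add1n normal_momentS subn1.
Qed.

Lemma gauss_exp_CauchySchwarz p q : gauss_exp (p ^+ 2) = 1 ->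
  gauss_exp (p * q) ^+ 2 <= gauss_exp (q ^+ 2).
Proof.
move=> p1; have := gauss_exp_sqr_ge0 (q - gauss_exp (p * q) *: p).
rewrite (_ : (q - _) ^+ 2 = q ^+ 2 - (2 * gauss_exp (p * q)) *: (p * q)
     + gauss_exp (p * q) ^+ 2 *: p ^+ 2).
  rewrite linearD linearB/= !linearZ/= p1 /(_ *: _)/=; lra.
by rewrite sqrrB exprZn -scalerAr (mulrC q) -scaler_nat scalerA.
Qed.
End GaussianExpectation.

(** * Creation operators and truncated likelihoods *)

Section CreationAnnihilation.
Variables (R : realType) (K : nat).
Local Notation P := (mpoly.mpoly K R).
Implicit Types (p q : P) (u v : 'I_K -> R).

Definition dot u v : R := \sum_j u j * v j.
Definition linform v : P := \sum_j v j *: 'X_j.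
Definition dderiv v p : P := \sum_j v j *: mpoly.mderiv j p.
Definition creation v p : P := linform v * p - dderiv v p.

Lemma creationE v p : creation v p = linform v * p - dderiv v p.
Proof. by []. Qed.

Lemma dotC u v : dot u v = dot v u.
Proof. by apply: eq_bigr => j _; rewrite mulrC. Qed.

Lemma dderiv_is_linear v : linear (dderiv v).
Proof.
move=> a p q; rewrite /dderiv scaler_sumr -big_split; apply: eq_bigr => j _ /=.
by rewrite linearP/= scalerDr !scalerA mulrC.
Qed.
HB.instance Definition _ v := GRing.isLinear.Build R P P *:%R (dderiv v)
    (dderiv_is_linear v).

Lemma creation_is_linear v : linear (creation v).
Proof.
move=> a p q; rewrite /creation linearP/= mulrDr -scalerAr scalerBr opprD.
by rewrite addrACA.
Qed.
HB.instance Definition _ v := GRing.isLinear.Build R P P *:%R (creation v)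
    (creation_is_linear v).

Local Arguments dderiv : simpl never.
Local Arguments creation : simpl never.

Lemma dderivM v p q : dderiv v (p * q) = dderiv v p * q + p * dderiv v q.
Proof.
rewrite /dderiv mulr_suml mulr_sumr -big_split; apply: eq_bigr => j _ /=.
by rewrite mpoly.mderivM scalerDr scalerAl scalerAr.
Qed.

Lemma mderivXU i j : mpoly.mderiv j ('X_i : P) = (i == j)%:R *: 1.
Proof.
rewrite mpoly.mderivX mpoly.mnm1E; have [->|] := eqVneq i j; last by rewrite !scale0r.
congr (_ *: _); rewrite -mpoly.mpolyX0; congr mpoly.mpolyX.
by apply/mpoly.mnmP => k; rewrite mpoly.mnmBE subnn mpoly.mnm0E.
Qed.

Lemma dderivX v i : dderiv v 'X_i = v i *: 1.
Proof.
rewrite /dderiv (bigD1 i)//= mderivXU eqxx scale1r big1 ?addr0// => j ji.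
by rewrite mderivXU eq_sym (negbTE ji) scale0r scaler0.
Qed.

Lemma dderiv1 v : dderiv v 1 = 0.
Proof. by rewrite /dderiv big1// => j _; rewrite mpoly.mderivC scaler0. Qed.

Lemma dderiv_linform u v : dderiv u (linform v) = dot u v *: 1.
Proof.
rewrite /linform linear_sum /dot scaler_suml; apply: eq_bigr => j _.
by rewrite linearZ/= dderivX scalerA mulrC.
Qed.

Lemma dderiv_mderiv v j p : dderiv v (mpoly.mderiv j p) = mpoly.mderiv j (dderiv v p).
Proof.
rewrite /dderiv [RHS]linear_sum; apply: eq_bigr => i _.
by rewrite linearZ/= mpoly.mderiv_comm.
Qed.

Lemma dderiv_comm u v p : dderiv u (dderiv v p) = dderiv v (dderiv u p).
Proof.
rewrite {2}/dderiv {3}/dderiv linear_sum; apply: eq_bigr => i _.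
by rewrite linearZ/= dderiv_mderiv.
Qed.

(** The canonical commutation relation, from which all the identities on [wick] follow. *)
Lemma dderiv_creation u v p :
  dderiv u (creation v p) = creation v (dderiv u p) + dot u v *: p.
Proof.
rewrite /creation linearB/= dderivM dderiv_linform -scalerAl mul1r dderiv_comm.
by rewrite -addrA addrC.
Qed.

Lemma gauss_exp_linform v p : gauss_exp (linform v * p) = gauss_exp (dderiv v p).
Proof.
rewrite /linform /dderiv mulr_suml !linear_sum; apply: eq_bigr => j _.
by rewrite -scalerAl !linearZ/= gauss_exp_ibp.
Qed.

Lemma gauss_exp_creation v p q :
  gauss_exp (p * creation v q) = gauss_exp (dderiv v p * q).
Proof.
rewrite /creation mulrBr mulrCA linearB/= gauss_exp_linform dderivM linearD/=.
by rewrite addrK.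
Qed.

(** The scalar produced by the commutation relation is symmetric in u and v. *)
Lemma creation_comm u v p : creation u (creation v p) = creation v (creation u p).
Proof.
rewrite [LHS]creationE [RHS]creationE !dderiv_creation !creationE (dotC v u).
rewrite (dderiv_comm v u) !mulrBr !mulrA (mulrC (linform v) (linform u)).
set a := _ * _ * _; set b := linform u * _; set c := linform v * _.
set d := dderiv u _; set e := _ *: p.
ring.
Qed.

Variable m : nat.
Implicit Types (w : 'I_m -> 'I_K -> R) (rho : R).

Definition laplace w p : P := \sum_i dderiv (w i) (dderiv (w i) p).
Definition creation2 w p : P := \sum_i creation (w i) (creation (w i) p).
(** An element of the Wiener chaos of order 2 k, whence the orthogonality for distinct k. *)
Definition wick w k : P := iter k (creation2 w) 1.

Lemma laplace_is_linear w : linear (laplace w).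
Proof.
move=> a p q; rewrite /laplace scaler_sumr -big_split; apply: eq_bigr => i _ /=.
by rewrite !linearP.
Qed.
HB.instance Definition _ w := GRing.isLinear.Build R P P *:%R (laplace w)
    (laplace_is_linear w).

Lemma creation2_is_linear w : linear (creation2 w).
Proof.
move=> a p q; rewrite /creation2 scaler_sumr -big_split; apply: eq_bigr => i _ /=.
by rewrite !linearP.
Qed.
HB.instance Definition _ w := GRing.isLinear.Build R P P *:%R (creation2 w)
    (creation2_is_linear w).

Local Arguments laplace : simpl never.
Local Arguments creation2 : simpl never.

Lemma creation_creation2 v w p :
  creation v (creation2 w p) = creation2 w (creation v p).
Proof.
rewrite /creation2 linear_sum; apply: eq_bigr => i _ /=.
by rewrite creation_comm; congr creation; rewrite creation_comm.
Qed.

Lemma gauss_exp_creation2 w p q :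
  gauss_exp (p * creation2 w q) = gauss_exp (laplace w p * q).
Proof.
rewrite /creation2 /laplace mulr_sumr mulr_suml !linear_sum; apply: eq_bigr => i _ /=.
by rewrite !gauss_exp_creation.
Qed.

Lemma gauss_exp_wick w k p : gauss_exp (p * wick w k) = gauss_exp (iter k (laplace w)
    p).
Proof.
elim: k p => [|k IH] p; first by rewrite /wick mulr1.
by rewrite [wick _ _]iterS gauss_exp_creation2 IH -iterSr.
Qed.

Lemma laplace1 w : laplace w 1 = 0.
Proof. by rewrite /laplace big1// => i _; rewrite dderiv1 linear0. Qed.

Lemma iter_laplaceZ w k (a : R) p :
  iter k (laplace w) (a *: p) = a *: iter k (laplace w) p.
Proof. by elim: k => //= k ->; rewrite linearZ. Qed.

Lemma iter_laplace0 w k : iter k (laplace w) 0 = 0.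
Proof. by elim: k => //= k ->; rewrite linear0. Qed.

Section Wick.
Variables (w w' : 'I_m -> 'I_K -> R) (rho : R).
Hypothesis dotw : forall i j, dot (w i) (w' j) = rho *+ (i == j).

(** Only the summand of index i fails to commute with the derivative, once for each of its two
    creation operators. *)
Lemma dderiv_creation2 i p :
  dderiv (w i) (creation2 w' p) =
  creation2 w' (dderiv (w i) p) + (2 * rho) *: creation (w' i) p.
Proof.
rewrite /creation2 linear_sum/=.
rewrite (eq_bigr (fun j => creation (w' j) (creation (w' j) (dderiv (w i) p)) +
    (if j == i then (2 * rho) *: creation (w' i) p else 0))).
  by rewrite big_split/= -big_mkcond big_pred1_eq.
move=> j _; rewrite !dderiv_creation linearD/= linearZ/= dotw -addrA -scalerDl.
rewrite eq_sym; case: eqVneq => [->|_]; first by rewrite mulr1n -mulr2n mulr_natl.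
by rewrite mulr0n addr0 scale0r.
Qed.

(** Each of the k+1 factors [creation2] releases the same creation operator, which commutes with the
    remaining factors; the derivative finally kills 1. *)
Lemma dderiv_wick i k :
  dderiv (w i) (wick w' k.+1) = (2 * rho * k.+1%:R) *: creation (w' i) (wick w' k).
Proof.
elim: k => [|k IH].
  by rewrite [wick _ _]iterS dderiv_creation2 dderiv1 linear0 add0r mulr1.
rewrite [wick _ _]iterS -/(wick w' k.+1) dderiv_creation2 IH linearZ/=.
rewrite -creation_creation2 -[creation2 w' _]/(wick w' k.+1) -scalerDl.
by congr (_ *: _); rewrite -[k.+2]addn1 natrD mulrDr mulr1.
Qed.

(** The second derivative either meets the released creation operator, giving rho for each of the m
    directions, or one of the k remaining factors, which rebuilds [wick w' k] with total weight 2 k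
    rho. *)
Lemma laplace_wick k :
  laplace w (wick w' k.+1) = (rho ^+ 2 * (2 * k.+1)%:R * (2 * k + m)%:R) *: wick w' k.
Proof.
rewrite /laplace; under eq_bigr => i _ do rewrite dderiv_wick linearZ/=
    dderiv_creation dotw eqxx mulr1n.
rewrite -scaler_sumr big_split/= sumr_const card_ord.
case: k => [|k].
  rewrite big1 => [|i _]; last by rewrite dderiv1 linear0.
  rewrite add0r -[_ *+ m]scaler_nat !scalerA muln0 add0n.
  by congr (_ *: _); rewrite mulr1 natrM; ring.
under eq_bigr => i _ do rewrite dderiv_wick linearZ/=.
rewrite -scaler_sumr -[\sum_i _]/(wick w' k.+1) -[_ *+ m]scaler_nat !scalerA
    -scalerDl scalerA.
by congr (_ *: _); rewrite !natrM natrD natrM; ring.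
Qed.

(** Each [creation2] crosses the expectation as a [laplace], which lowers the other side by one.
    Unless both sides run out together, some [laplace] is applied to 1. *)
Lemma gauss_exp_wick_wick k l :
  gauss_exp (wick w k * wick w' l) =
  (\prod_(j < k) (rho ^+ 2 * (2 * j.+1)%:R * (2 * j + m)%:R)) *+ (k == l).
Proof.
rewrite mulrC gauss_exp_wick; elim: k l => [|k IH] [|l].
- by rewrite big_ord0 mulr1n; exact: gauss_exp1.
- by rewrite -[iter 0 _ _]mul1r gauss_exp_wick iterSr laplace1 iter_laplace0 linear0.
- by rewrite iterSr laplace1 iter_laplace0 linear0.
- rewrite iterSr laplace_wick iter_laplaceZ linearZ/= IH eqSS big_ord_recr/= mulrC.
  by rewrite mulrnAl; case: eqVneq => [->|_] //; rewrite !mulr0n.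
Qed.
End Wick.

End CreationAnnihilation.

Local Arguments dderiv : simpl never.
Local Arguments creation : simpl never.
Local Arguments laplace : simpl never.
Local Arguments creation2 : simpl never.

(** * Degree bounds and induction on polynomials *)

Section Degree.
Variables (R : realType) (K : nat).
Local Notation P := (mpoly.mpoly K R).
Implicit Types (p q : P) (v : 'I_K -> R).

(** Strict and coefficientwise: the bound 0 characterizes the zero polynomial, and stability under
    sums, scaling and derivatives is read off the coefficients. *)
Definition deg_lt n p := forall a : mpoly.multinom K, (n <= mpoly.mdeg a)%N ->
    mpoly.mcoeff a p = 0.

Lemma deg_lt_msize p : deg_lt (mpoly.msize p) p.
Proof. by move=> a na; apply: mpoly.memN_msupp_eq0; exact: mpoly.msize_mdeg_ge. Qed.

Lemma deg_ltW n k p : (n <= k)%N -> deg_lt n p -> deg_lt k p.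
Proof. by move=> nk np a ka; apply: np; exact: leq_trans ka. Qed.

Lemma deg_lt0 p : deg_lt 0 p -> p = 0.
Proof. by move=> h; apply/mpoly.mpolyP => a; rewrite h// mpoly.mcoeff0. Qed.

Lemma deg_lt_sum n I (r : seq I) (F : I -> P) :
  (forall i, deg_lt n (F i)) -> deg_lt n (\sum_(i <- r) F i).
Proof. by move=> h a na; rewrite raddf_sum big1// => i _; exact: h. Qed.

Lemma deg_ltZ n (c : R) p : deg_lt n p -> deg_lt n (c *: p).
Proof. by move=> h a na; rewrite mpoly.mcoeffZ h// mulr0. Qed.

Lemma deg_lt_mderiv n j p : deg_lt n p -> deg_lt n.-1 (mpoly.mderiv j p).
Proof.
move=> h a na; rewrite mpoly.mcoeff_mderiv h ?mul0rn// mpoly.mdegD mpoly.mdeg1.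
by rewrite addn1; case: n na {h}.
Qed.

Lemma deg_lt_dderiv n v p : deg_lt n p -> deg_lt n.-1 (dderiv v p).
Proof.
by move=> h; apply: deg_lt_sum => j; apply: deg_ltZ; exact: deg_lt_mderiv.
Qed.

Lemma iter_laplace_eq0 m (w : 'I_m -> 'I_K -> R) k p :
  deg_lt (2 * k) p -> iter k (laplace w) p = 0.
Proof.
elim: k p => [|k IH] p h; first exact: deg_lt0.
rewrite iterSr; apply: IH; apply: deg_lt_sum => i.
rewrite mulnS in h.
by have := deg_lt_dderiv (w i) (deg_lt_dderiv (w i) h).
Qed.

(** An induction shaped for integration by parts: for ['X_j * p] the hypothesis covers every
    polynomial with the degree bound of p, because derivatives of p will occur. *)
Lemma mpoly_mulX_ind (Q : nat -> P -> Prop) :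
  (forall n (c : R) p q, Q n p -> Q n q -> Q n (c *: p + q)) ->
  (forall n, Q n 0) ->
  (forall n, Q n.+1 1) ->
  (forall n j p, deg_lt n p -> (forall q, deg_lt n q -> Q n q) -> Q n.+1 ('X_j * p)) ->
  forall n p, deg_lt n p -> Q n p.
Proof.
move=> QP Q0 Q1 QX; elim=> [|n IH] p hp; first by rewrite (deg_lt0 hp).
have QM a : (mpoly.mdeg a <= n)%N -> Q n.+1 (mpoly.mpolyX R a).
  move=> an; have [->|a0] := eqVneq a (@mpoly.mnm0 K); first by rewrite mpoly.mpolyX0.
  have [j aj] : exists j, a j != 0%N.
    apply/existsP; apply: contraNT a0 => /existsPn h; apply/eqP/mpoly.mnmP => j.
    by rewrite mpoly.mnm0E; apply/eqP; have := h j; rewrite negbK.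
  have e : a = mpoly.mnm_add (mpoly.mnm1 j) (mpoly.mnm_sub a (mpoly.mnm1 j)).
    by rewrite mpoly.addmC mpoly.submK// mpoly.lep1mP.
  rewrite e mpoly.mpolyXD; apply: QX => // b nb.
  rewrite mpoly.mcoeffX; case: eqVneq => // eb; move: nb.
  rewrite -eb leqNgt => /negP[]; apply: leq_trans an.
  by rewrite [X in (_ < mpoly.mdeg X)%N]e mpoly.mdegD mpoly.mdeg1.
rewrite [p]mpoly.mpolyE.
have : forall a, a \in mpoly.msupp p -> (mpoly.mdeg a <= n)%N.
  move=> a; rewrite mpoly.mcoeff_msupp leqNgt; apply: contra_neqN => an.
  exact: hp.
elim: (mpoly.msupp p) => [|a s IHs] hs; first by rewrite big_nil.
rewrite big_cons; apply: QP; first by apply: QM; apply: hs; rewrite mem_head.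
by apply: IHs => b bs; apply: hs; rewrite in_cons bs orbT.
Qed.
End Degree.

(** * The chain rule for substitutions *)

Section Projection.
Variables (R : realType) (K m : nat).
Local Notation P := (mpoly.mpoly K R).
Implicit Types (p q : P) (w : 'I_m -> 'I_K -> R).

Lemma comp_mpoly_mulX (t : K.-tuple P) j p :
  mpoly.comp_mpoly t ('X_j * p) = tnth t j * mpoly.comp_mpoly t p.
Proof.
have e : mpoly.comp_mpoly t ('X_j : P) = tnth t j.
  by rewrite /mpoly.comp_mpoly mpoly.mmapX mpoly.mmap1U.
by rewrite rmorphM/= e.
Qed.

Lemma mderiv_mulX i j p :
  mpoly.mderiv i ('X_j * p) = (j == i)%:R *: p + 'X_j * mpoly.mderiv i p.
Proof. by rewrite mpoly.mderivM mderivXU -scalerAl mul1r. Qed.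

Lemma mderiv_comp (t : K.-tuple P) i p :
  mpoly.mderiv i (mpoly.comp_mpoly t p) =
  \sum_l mpoly.comp_mpoly t (mpoly.mderiv l p) * mpoly.mderiv i (tnth t l).
Proof.
apply: (@mpoly_mulX_ind R K (fun _ p => mpoly.mderiv i (mpoly.comp_mpoly t p) =
  \sum_l mpoly.comp_mpoly t (mpoly.mderiv l p) * mpoly.mderiv i (tnth t l)) _ _ _ _
   (mpoly.msize p)); last exact: deg_lt_msize.
- move=> _ c {}p q hp hq; rewrite !linearP/= hp hq scaler_sumr -big_split.
  by apply: eq_bigr => l _ /=; rewrite !linearP/= mulrDl scalerAl.
- by move=> _; rewrite !linear0 big1// => l _; rewrite !linear0 mul0r.
- move=> _; rewrite rmorph1 mpoly.mderivC big1// => l _.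
  by rewrite mpoly.mderivC linear0 mul0r.
- move=> n j {}p hp IH; rewrite comp_mpoly_mulX mpoly.mderivM IH// mulr_sumr.
  under [RHS]eq_bigr => l _ do rewrite mderiv_mulX linearP/= comp_mpoly_mulX mulrDl.
  rewrite big_split/=; congr (_ + _).
    rewrite (bigD1 j)//= eqxx scale1r big1 ?addr0; first by rewrite mulrC.
    by move=> l lj; rewrite eq_sym (negbTE lj) scale0r mul0r.
  by apply: eq_bigr => l _; rewrite mulrA.
Qed.
End Projection.

(** * The truncated likelihood represents the projected Gaussian *)

Section Likelihood.
Variables (R : realType) (K m : nat).
Local Notation P := (mpoly.mpoly K R).
Implicit Types (p q : P) (w : 'I_m -> 'I_K -> R).

(** The Taylor coefficients of exp (- x / 2). *)
Definition lik_coef k : R := (- 2^-1) ^+ k / k`!%:R.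
Definition likelihood w h : P := \sum_(k < h.+1) lik_coef k *: wick w k.

Lemma lik_coefS k : lik_coef k.+1 * (2 * k.+1%:R) = - lik_coef k.
Proof.
have f0 : k`!%:R != 0 :> R by rewrite pnatr_eq0 -lt0n fact_gt0.
have k0 : k.+1%:R != 0 :> R by rewrite pnatr_eq0.
rewrite /lik_coef exprS factS natrM; move: (k.+1%:R) k0 => y y0.
by field; rewrite f0 y0.
Qed.

Lemma gauss_exp_likelihood w h p : gauss_exp (p * likelihood w h) =
  \sum_(k < h.+1) lik_coef k * gauss_exp (iter k (laplace w) p).
Proof.
rewrite /likelihood mulr_sumr linear_sum; apply: eq_bigr => k _.
by rewrite -scalerAr linearZ/= gauss_exp_wick.
Qed.

(* The generalized binomial coefficient ['C(m / 2 + k - 1, k)]. *)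
Definition adv_coef k : R := \prod_(j < k) ((2 * j + m)%:R / (2 * j.+1)%:R).

(** Distinct [wick] terms are orthogonal. On the diagonal the squared coefficient contributes (2 (j
    + 1))^-2 for each j < k, which turns the norm of [wick] into [adv_coef]. *)
Lemma gauss_exp_likelihood2 w w' rho h :
  (forall i j, dot (w i) (w' j) = rho *+ (i == j)) ->
  gauss_exp (likelihood w h * likelihood w' h) =
  \sum_(k < h.+1) adv_coef k * rho ^+ (2 * k).
Proof.
move=> dotw; rewrite {1}/likelihood mulr_suml linear_sum; apply: eq_bigr => k _.
rewrite /likelihood mulr_sumr linear_sum (bigD1 k)//= big1 ?addr0; last first.
  move=> l lk; rewrite -scalerAl -scalerAr !linearZ/= (gauss_exp_wick_wick dotw).
  by rewrite eq_sym val_eqE (negbTE lk) mulr0n !mulr0.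
rewrite -scalerAl -scalerAr !linearZ/= (gauss_exp_wick_wick dotw) eqxx mulr1n.
rewrite /adv_coef; elim: (val k) => [|j IH]; rewrite ?big_ord0 ?big_ord_recr/=.
  by rewrite /lik_coef fact0 !expr0 divr1 !mulr1.
have -> : rho ^+ (2 * j.+1) = rho ^+ (2 * j) * rho ^+ 2 by rewrite mulnS addnC exprD.
rewrite [RHS]mulrACA -IH.
have := lik_coefS j; move: (lik_coef j.+1) (lik_coef j) => x y e.
move: (\prod_(_ < _) _) => z.
have -> : y = - (x * (2 * j.+1%:R)) by rewrite e opprK.
have j0 : j.+1%:R != 0 :> R by rewrite pnatr_eq0.
by rewrite !natrM; field; rewrite -natr1 addrC in j0.
Qed.

(** For orthonormal w, the coordinates of the orthogonal projection of X onto the complement of the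
    span of the w_i. *)
Definition proj_tuple w : K.-tuple P :=
  [tuple 'X_j - \sum_i w i j *: linform (w i) | j < K].
Definition proj_comp w p : P := mpoly.comp_mpoly (proj_tuple w) p.

(** The j-th coordinate of (sum_i w_i w_i^T) applied to the gradient of p, that is, the part of the
    gradient that the projection removes. *)
Definition row_deriv w j p : P := \sum_i w i j *: dderiv (w i) p.

Lemma laplace_mulX w j p :
  laplace w ('X_j * p) = 'X_j * laplace w p + 2 *: row_deriv w j p.
Proof.
rewrite /laplace /row_deriv mulr_sumr scaler_sumr -big_split; apply: eq_bigr => i _ /=.
rewrite dderivM dderivX linearD/= -scalerAl mul1r linearZ/= dderivM dderivX -scalerAl
    mul1r.
by rewrite addrA addrC [2 *: _]scaler_nat mulr2n.
Qed.

Lemma row_deriv_is_linear w j : linear (row_deriv w j).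
Proof.
move=> a p q; rewrite /row_deriv scaler_sumr -big_split; apply: eq_bigr => i _ /=.
by rewrite linearP/= scalerDr !scalerA mulrC.
Qed.
HB.instance Definition _ w j :=
  GRing.isLinear.Build R P P *:%R (row_deriv w j) (row_deriv_is_linear w j).
Local Arguments row_deriv : simpl never.

Lemma laplace_mderiv w j p : laplace w (mpoly.mderiv j p) = mpoly.mderiv j (laplace w
    p).
Proof.
by rewrite /laplace linear_sum; apply: eq_bigr => i _; rewrite !dderiv_mderiv.
Qed.

Lemma laplace_dderiv w v p : laplace w (dderiv v p) = dderiv v (laplace w p).
Proof.
rewrite /laplace linear_sum; apply: eq_bigr => i _ /=.
by rewrite [in LHS](dderiv_comm _ v) [in LHS](dderiv_comm _ v).
Qed.

Lemma laplace_row_deriv w j p : laplace w (row_deriv w j p) = row_deriv w j (laplace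
    w p).
Proof.
rewrite {1}/row_deriv linear_sum; apply: eq_bigr => i _.
by rewrite linearZ/= laplace_dderiv.
Qed.

(** The commutator of [laplace] with X_j is twice [row_deriv w j], which itself commutes with
    [laplace]. *)
Lemma iter_laplace_mulX w k j p : iter k (laplace w) ('X_j * p) =
  'X_j * iter k (laplace w) p + (2 * k%:R) *: row_deriv w j (iter k.-1 (laplace w) p).
Proof.
elim: k => [|k IH]; first by rewrite /= mulr0 scale0r addr0.
rewrite iterS IH linearD/= laplace_mulX linearZ/= laplace_row_deriv -addrA.
congr (_ + _); case: k {IH} => [|k].
  by rewrite mulr0 scale0r addr0 mulr1.
rewrite /= -scalerDl; congr (_ *: _); rewrite -[k.+2]addn1 natrD; ring.
Qed.

(** The commutator terms carry the coefficients 2 k [lik_coef k], which [lik_coefS] shifts into the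
    same series one index lower, with a minus sign. *)
Lemma gauss_exp_likelihood_mulX w h j p : deg_lt (2 * h).+1 p ->
  gauss_exp ('X_j * p * likelihood w h) =
  gauss_exp (mpoly.mderiv j p * likelihood w h) -
  gauss_exp (row_deriv w j p * likelihood w h).
Proof.
move=> hp; rewrite !gauss_exp_likelihood.
under eq_bigr => k _ do rewrite iter_laplace_mulX linearD/= gauss_exp_ibp mulrDr.
rewrite big_split/=; congr (_ + _).
  apply: eq_bigr => k _; congr (_ * gauss_exp _).
  by elim: (val k) => //= i <-; rewrite laplace_mderiv.
rewrite big_ord_recl mulr0 scale0r linear0 mulr0 add0r.
(* The shift leaves the term k = h unmatched; it vanishes because [row_deriv w j p] has degree below
   2 h. *)
rewrite [in RHS]big_ord_recr/= iter_laplace_eq0 ?linear0 ?mulr0 ?addr0; last first.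
  by apply: deg_lt_sum => i; apply: deg_ltZ; have := deg_lt_dderiv (w i) hp.
rewrite -sumrN; apply: eq_bigr => k _.
rewrite linearZ/= mulrA lik_coefS mulNr; congr (- (_ * gauss_exp _)).
by elim: (val k) => //= i <-; rewrite laplace_row_deriv.
Qed.

Section Orthonormal.
Variable w : 'I_m -> 'I_K -> R.
Hypothesis dotw : forall i j, dot (w i) (w j) = (i == j)%:R.

Lemma dderiv_proj v l :
  dderiv v (tnth (proj_tuple w) l) = (v l - \sum_i w i l * dot v (w i)) *: 1.
Proof.
rewrite tnth_mktuple linearB/= dderivX (linear_sum (dderiv v))/= scalerBl
    scaler_suml; congr (_ - _).
by apply: eq_bigr => i _; rewrite linearZ/= dderiv_linform scalerA.
Qed.

Lemma mderiv_proj j l : mpoly.mderiv j (tnth (proj_tuple w) l) =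
  ((j == l)%:R - \sum_i w i l * w i j) *: 1.
Proof.
rewrite tnth_mktuple linearB/= mderivXU (linear_sum (mpoly.mderiv j))/= scalerBl
    scaler_suml eq_sym; congr (_ - _).
apply: eq_bigr => i _; rewrite linearZ/= -scalerA; congr (_ *: _).
rewrite /linform linear_sum (bigD1 j)//= linearZ/= mderivXU eqxx scale1r big1
    ?addr0// => k kj.
by rewrite linearZ/= mderivXU (negbTE kj) scale0r scaler0.
Qed.

(** A polynomial in the projected coordinates is constant along w_i, a direction that the projection
    kills. *)
Lemma dderiv_proj_comp i p : dderiv (w i) (proj_comp w p) = 0.
Proof.
have E v : dderiv v (proj_comp w p) = \sum_l
    mpoly.comp_mpoly (proj_tuple w) (mpoly.mderiv l p) * dderiv v (tnth (proj_tuple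
        w) l).
  rewrite /dderiv /proj_comp.
  under eq_bigr do rewrite mderiv_comp scaler_sumr.
  rewrite exchange_big; apply: eq_bigr => l _ /=.
  by rewrite mulr_sumr; apply: eq_bigr => j _; rewrite scalerAr.
rewrite E big1// => l _; rewrite dderiv_proj (bigD1 i)//= dotw eqxx mulr1 big1.
  by rewrite addr0 subrr scale0r mulr0.
by move=> k ki; rewrite dotw eq_sym (negbTE ki) mulr0.
Qed.

(** The subtracted forms [linform (w i)] contribute nothing: by parts, they become derivatives along
    w_i of a polynomial constant in that direction. *)
Lemma gauss_exp_proj_mulX j p : gauss_exp (proj_comp w ('X_j * p)) =
  gauss_exp (proj_comp w (mpoly.mderiv j p)) - gauss_exp (proj_comp w (row_deriv w j
      p)).
Proof.
rewrite {1}/proj_comp comp_mpoly_mulX -/(proj_comp w p) tnth_mktuple mulrBl linearB/=.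
rewrite mulr_suml [X in _ - X]linear_sum [X in _ - X]big1 ?subr0; last first.
  by move=> i _; rewrite -scalerAl linearZ/= gauss_exp_linform dderiv_proj_comp
      linear0 mulr0.
rewrite gauss_exp_ibp -linearB; congr gauss_exp; rewrite /proj_comp mderiv_comp.
under eq_bigr => l _ do rewrite mderiv_proj -scalerAr mulr1 scalerBl.
rewrite sumrB; congr (_ - _).
  rewrite (bigD1 j)//= eqxx scale1r big1 ?addr0// => l lj.
  by rewrite eq_sym (negbTE lj) scale0r.
rewrite /row_deriv linear_sum.
under eq_bigr do rewrite scaler_suml.
rewrite exchange_big; apply: eq_bigr => i _ /=.
rewrite /dderiv scaler_sumr linear_sum; apply: eq_bigr => l _.
by rewrite !linearZ/= scalerA mulrC.
Qed.

(* Both sides satisfy the integration by parts recursion for the covariance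
   [1 - \sum_i w_i w_i^T]. *)
Lemma gauss_exp_proj_comp h p : deg_lt (2 * h).+2 p ->
  gauss_exp (proj_comp w p) = gauss_exp (p * likelihood w h).
Proof.
move=> hp.
(* The ceiling on n ensures that the cofactor of X_j has degree at most 2 h, as the recursion for
   the truncated likelihood requires. *)
suff : forall n q, deg_lt n q -> (n <= (2 * h).+2)%N ->
    gauss_exp (proj_comp w q) = gauss_exp (q * likelihood w h) by apply; eauto.
apply: mpoly_mulX_ind.
- move=> n c {hp}p q hp hq hn; rewrite /proj_comp linearP linearP/= mulrDl -scalerAl
    linearP/=.
  by rewrite -!/(proj_comp w _) hp ?hq.
- by move=> n _; rewrite /proj_comp linear0 mul0r.
- move=> n _; rewrite /proj_comp rmorph1 gauss_exp1 gauss_exp_likelihood big_ord_recl/=.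
  rewrite /lik_coef expr0 fact0 divr1 mul1r gauss_exp1 big1 ?addr0// => i _.
  by rewrite -iterS iterSr laplace1 iter_laplace0 linear0 mulr0.
- move=> n j q hq IH; rewrite ltnS => hn.
  rewrite gauss_exp_proj_mulX gauss_exp_likelihood_mulX; last exact: deg_ltW hq.
  have hd v : deg_lt n (dderiv v q) by apply: deg_ltW (deg_lt_dderiv v hq);
      exact: leq_pred.
  rewrite !IH ?(leqW hn)//.
    by apply: deg_lt_sum => i; apply: deg_ltZ.
  by apply: deg_ltW (deg_lt_mderiv j hq); exact: leq_pred.
Qed.
End Orthonormal.
End Likelihood.

(** * Bounds on the advantage *)

Section Khintchine.
Variable R : realType.

Lemma powM_swap_le (x y : R) i j : 0 <= x -> 0 <= y ->
  x ^+ i * y ^+ j + x ^+ j * y ^+ i <= x ^+ (i + j) + y ^+ (i + j).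
Proof.
move=> x0 y0; rewrite !exprD.
have : 0 <= (x ^+ i - y ^+ i) * (x ^+ j - y ^+ j).
  have [xy|/ltW yx] := leP x y.
    by apply: mulr_le0; rewrite subr_le0 lerXn2r.
  by apply: mulr_ge0; rewrite subr_ge0 lerXn2r.
by move: (x ^+ i) (x ^+ j) (y ^+ i) (y ^+ j) => a b c d; lra.
Qed.

(** A discrete substitute for differentiating x^(2p+1). The difference quotient has 2p+1 mixed
    monomials; pairing index i with 2p - i yields the factor 1/2. *)
Lemma subr_powM_le (a b : R) p :
  (a - b) * (a ^+ (2 * p).+1 - b ^+ (2 * p).+1) <=
  (2 * p).+1%:R / 2 * (a - b) ^+ 2 * (a ^+ (2 * p) + b ^+ (2 * p)).
Proof.
rewrite subrXX mulrA -expr2 [leRHS]mulrAC [leRHS]mulrC ler_wpM2l ?sqr_ge0//=.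
pose S := \sum_(i < (2 * p).+1) `|a| ^+ (2 * p - i) * `|b| ^+ i.
apply: (@le_trans _ _ S).
  apply: ler_sum => i _; apply: le_trans (ler_norm _) _.
  by rewrite normrM !normrX.
have SE : S = \sum_(i < (2 * p).+1) `|a| ^+ i * `|b| ^+ (2 * p - i).
  rewrite /S (reindex_inj rev_ord_inj)/=; apply: eq_bigr => i _.
  by rewrite subSS subKn// -ltnS.
have : S + S <= (2 * p).+1%:R * (a ^+ (2 * p) + b ^+ (2 * p)).
  rewrite {1}SE -big_split/=.
  rewrite mulr_natl -[X in _ *+ X]card_ord -sumr_const; apply: ler_sum => i _.
  apply: le_trans (powM_swap_le _ _ (normr_ge0 _) (normr_ge0 _)) _.
  rewrite subnKC -1?ltnS// !exprM.
  by rewrite !real_normK ?num_real.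
by move: (a ^+ _ + _) (_%:R) => u v; lra.
Qed.

Definition rsign (b : bool) : R := (-1) ^+ b.

Lemma rsign_sqr b : rsign b ^+ 2 = 1.
Proof. by rewrite /rsign sqrr_sign. Qed.

(** The double factorial (2 p - 1)!!, which is the Gaussian moment of order 2 p. *)
Definition odd_fact p : R := \prod_(j < p) (2 * j).+1%:R.

Section Flip.
Variable n : nat.
Local Notation signs := {ffun 'I_n -> bool}.

Definition flip (i : 'I_n) (s : signs) : signs :=
  [ffun j => if j == i then ~~ s j else s j].

Lemma flipK i : involutive (flip i).
Proof. by move=> s; apply/ffunP => j; rewrite !ffunE; case: eqP => //;
    rewrite negbK. Qed.

Variable c : 'I_n -> R.
Definition rademacher_sum (s : signs) : R := \sum_i c i * rsign (s i).

Lemma rademacher_sum_flip i s :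
  rademacher_sum (flip i s) = rademacher_sum s - 2 * (c i * rsign (s i)).
Proof.
rewrite /rademacher_sum !(bigD1 i (P := xpredT))//= ffunE eqxx.
rewrite (eq_bigr (fun j => c j * rsign (s j))) => [|j ji].
  by rewrite /rsign; case: (s i); rewrite /= ?expr0 ?expr1; lra.
by rewrite ffunE (negbTE ji).
Qed.

(** Induction on p imitating Gaussian integration by parts: one factor of the power is expanded as a
    sum over i, and each summand is antisymmetrized under the flip of sign i, which changes the
    Rademacher sum by 2 c_i times that sign. Sums over signs are not normalized, hence 2^n. *)
Lemma khintchine p :
  \sum_(s : signs) rademacher_sum s ^+ (2 * p) <=
  2 ^+ n * odd_fact p * (\sum_i c i ^+ 2) ^+ p.
Proof.
elim: p => [|p IH].
  rewrite /odd_fact big_ord0 !mulr1 muln0 sumr_const card_ffun card_bool card_ord.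
  by rewrite -natrX.
have step i : \sum_(s : signs) c i * rsign (s i) * rademacher_sum s ^+ (2 * p).+1 <=
    (2 * p).+1%:R * c i ^+ 2 * \sum_(s : signs) rademacher_sum s ^+ (2 * p).
  have e k : \sum_(s : signs) rademacher_sum (flip i s) ^+ k = \sum_(s : signs)
      rademacher_sum s ^+ k.
    by rewrite [RHS](reindex_inj (inv_inj (flipK i))).
  have e2 : \sum_(s : signs) c i * rsign (s i) * rademacher_sum s ^+ (2 * p).+1 =
      - \sum_(s : signs) c i * rsign (s i) * rademacher_sum (flip i s) ^+ (2 * p).+1.
    rewrite (reindex_inj (inv_inj (flipK i))) -sumrN; apply: eq_bigr => s _.
    by rewrite ffunE eqxx /rsign; case: (s i); rewrite /= ?expr0 ?expr1; lra.
  have : \sum_(s : signs) c i * rsign (s i) * rademacher_sum s ^+ (2 * p).+1 -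
      \sum_(s : signs) c i * rsign (s i) * rademacher_sum (flip i s) ^+ (2 * p).+1 <=
      (2 * p).+1%:R * c i ^+ 2 * (\sum_(s : signs) rademacher_sum s ^+ (2 * p) +
      \sum_(s : signs) rademacher_sum (flip i s) ^+ (2 * p)).
    rewrite -sumrB -big_split/= mulr_sumr; apply: ler_sum => s _.
    have := subr_powM_le (rademacher_sum s) (rademacher_sum (flip i s)) p.
    have -> : rademacher_sum s - rademacher_sum (flip i s) = 2 * (c i * rsign (s i)).
      by rewrite rademacher_sum_flip; ring.
    rewrite !exprMn rsign_sqr.
    move: (rademacher_sum s ^+ (2 * p).+1) (rademacher_sum (flip i s) ^+ (2 * p).+1).
    move: (rademacher_sum s ^+ (2 * p)) (rademacher_sum (flip i s) ^+ (2 * p)).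
    move: ((2 * p).+1%:R) (c i) (rsign _) => u x y a b a' b'; lra.
  rewrite e; lra.
apply: (@le_trans _ _ ((2 * p).+1%:R * (\sum_i c i ^+ 2) * \sum_(s : signs)
    rademacher_sum s ^+ (2 * p))).
  rewrite mulr_sumr mulr_suml; apply: le_trans (ler_sum _ (fun i _ => step i)).
  rewrite exchange_big/=; apply: ler_sum => s _.
  by rewrite (_ : 2 * p.+1 = (2 * p).+2)%N ?mulnS// exprS -mulr_suml.
apply: (@le_trans _ _ ((2 * p).+1%:R * (\sum_i c i ^+ 2) *
    (2 ^+ n * odd_fact p * (\sum_i c i ^+ 2) ^+ p))).
  by rewrite ler_wpM2l// mulr_ge0// sumr_ge0// => i _; rewrite sqr_ge0.
rewrite /odd_fact big_ord_recr/= exprS le_eqVlt; apply/orP; left; apply/eqP; ring.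
Qed.
End Flip.

Lemma bernoulli2 (x : R) p : 0 <= x ->
  1 + p%:R * x + p%:R * (p%:R - 1) / 2 * x ^+ 2 <= (1 + x) ^+ p.
Proof.
move=> x0; elim: p => [|p IH]; first by rewrite expr0; lra.
rewrite [leRHS]exprS -natr1; apply: (@le_trans _ _ ((1 + x) * (1 + p%:R * x + p%:R *
    (p%:R - 1) / 2 * x ^+ 2))).
  have : 0 <= p%:R * (p%:R - 1) * x ^+ 3.
    apply: mulr_ge0; last exact: exprn_ge0.
    case: p {IH} => [|p]; first by rewrite mul0r.
    by rewrite mulr_ge0// subr_ge0 ler1n.
  move: (p%:R) => y; nra.
by rewrite ler_wpM2l// addr_ge0.
Qed.

Lemma odd_fact_ge0 p : 0 <= odd_fact p.
Proof. by apply: prodr_ge0. Qed.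

(** The true growth is of order (2 p / e)^p; 4/5 is a rational above 2/e, and 5/4 makes p = 1 an
    equality. *)
Lemma odd_fact_le p : odd_fact p <= 5 / 4 * (4 / 5 * p%:R) ^+ p.
Proof.
elim: p => [|p IH]; first by rewrite /odd_fact big_ord0 expr0; lra.
rewrite /odd_fact big_ord_recr/= -/(odd_fact p).
case: p IH => [|p] IH; first by rewrite /odd_fact big_ord0 expr1; lra.
have : (0 < p.+1)%N by [].
move: (p.+1) IH => q IH q_gt0.
have q1 : 1 <= q%:R :> R by rewrite ler1n.
have q0 : 0 < q%:R :> R by rewrite ltr0n.
(* The second-order Bernoulli bound at 1/q, precise enough to control the ratio of consecutive
   terms. *)
have b : 5 / 2 - 1 / (2 * q%:R) <= (1 + q%:R^-1) ^+ q :> R.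
  have := @bernoulli2 (q%:R^-1) q; rewrite invr_ge0 ler0n => /(_ isT) h;
      apply: le_trans h.
  by rewrite le_eqVlt; apply/orP; left; apply/eqP; field; rewrite gt_eqF.
have e : (4 / 5 * q.+1%:R) ^+ q.+1 =
    4 / 5 * (q%:R + 1) * ((4 / 5 * q%:R) ^+ q * (1 + q%:R^-1) ^+ q) :> R.
  rewrite exprS -[q.+1%:R]natr1; congr (_ * _); rewrite -exprMn; congr (_ ^+ _).
  by field; rewrite gt_eqF.
rewrite e; set X := (4 / 5 * q%:R) ^+ q in IH *.
have X0 : 0 <= X by apply: exprn_ge0; rewrite mulr_ge0//; lra.
have n1 : (2 * q).+1%:R = 2 * q%:R + 1 :> R by rewrite -natr1 natrM.
rewrite n1; apply: (@le_trans _ _ (5 / 4 * X * (2 * q%:R + 1))).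
  by rewrite ler_wpM2r// addr_ge0// mulr_ge0// ltW.
have : 2 * q%:R + 1 <= 4 / 5 * (q%:R + 1) * (1 + q%:R^-1) ^+ q :> R.
  apply: (@le_trans _ _ (4 / 5 * (q%:R + 1) * (5 / 2 - 1 / (2 * q%:R)))).
    have -> : 4 / 5 * (q%:R + 1) * (5 / 2 - 1 / (2 * q%:R)) =
       2 * q%:R + 2 - 2 / 5 - 2 / 5 / q%:R :> R by field; rewrite gt_eqF.
    have : q%:R^-1 <= 1 :> R by rewrite invf_le1.
    by move: (q%:R^-1) => z; lra.
  by rewrite ler_wpM2l// mulr_ge0// ?addr_ge0//; lra.
move=> h; have := ler_wpM2l X0 h.
lra.
Qed.

End Khintchine.

(** * Geometric decay of the terms of the series *)

Section AdvantageSeries.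
Variable R : realType.

Lemma adv_coef_ge0 m k : 0 <= adv_coef R m k.
Proof. by apply: prodr_ge0 => j _; rewrite divr_ge0. Qed.

(** The right-hand side equals C(m + k, k + 1), so the bound amounts to replacing m/2 by m. The
    factor m is kept apart so that it can later be paired with t. *)
Lemma adv_coefS_le m k :
  adv_coef R m k.+1 <= m%:R / k.+1%:R * 'C(m + k, k)%:R.
Proof.
elim: k => [|k IH].
  rewrite /adv_coef big_ord1 bin0 mulr1 muln0 add0n muln1 divr1.
  by rewrite ler_pdivrMr// ler_peMr// ler1n.
rewrite /adv_coef big_ord_recr/= -/(adv_coef R m k.+1).
have k1 : 0 < k.+1%:R :> R by rewrite ltr0n.
have k2 : 0 < k.+2%:R :> R by rewrite ltr0n.
have hb : 'C(m + k.+1, k.+1)%:R = (m + k.+1)%:R / k.+1%:R * 'C(m + k, k)%:R :> R.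
  apply: (mulfI (lt0r_neq0 k1)); rewrite -natrM -mul_bin_diag addnS/= natrM mulrA.
  by rewrite mulrCA divff ?gt_eqF// mulr1.
rewrite hb; set B := 'C(m + k, k)%:R in IH *.
apply: (@le_trans _ _ (m%:R / k.+1%:R * B * ((2 * k.+1 + m)%:R / (2 * k.+2)%:R))).
  by rewrite ler_wpM2r// divr_ge0.
have B0 : 0 <= m%:R * B by rewrite mulr_ge0.
have -> : m%:R / k.+1%:R * B * ((2 * k.+1 + m)%:R / (2 * k.+2)%:R) =
   m%:R * B / (k.+1%:R * k.+2%:R) * (k.+1%:R + m%:R / 2).
  rewrite natrD !natrM; move: k1 k2; move: (k.+1%:R) (k.+2%:R) => x y x0 y0.
  by field; rewrite !gt_eqF.
have -> : m%:R / k.+2%:R * ((m + k.+1)%:R / k.+1%:R * B) =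
   m%:R * B / (k.+1%:R * k.+2%:R) * (k.+1%:R + m%:R).
  rewrite natrD; move: k1 k2; move: (k.+1%:R) (k.+2%:R) => x y x0 y0.
  by field; rewrite !gt_eqF.
rewrite ler_wpM2l ?divr_ge0 ?mulr_ge0// lerD2l.
by rewrite ler_pdivrMr// ler_peMr// ler1n.
Qed.

(** The left-hand side is a single term of the expansion of (1 - t + t)^(m + k). *)
Lemma binomial_term_le1 m k (t : R) : 0 <= t <= 1 ->
  'C(m + k, k)%:R * t ^+ k * (1 - t) ^+ m <= 1.
Proof.
move=> /andP[t0 t1].
have e : (1 - t + t) ^+ (m + k) = 1 by rewrite subrK expr1n.
rewrite -[leRHS]e [leRHS]exprDn (bigD1 (Ordinal (leq_addl m k : (k < (m +
    k).+1)%N)))//= addnK.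
have -> : 'C(m + k, k)%:R * t ^+ k * (1 - t) ^+ m =
    (1 - t) ^+ m * t ^+ k *+ 'C(m + k, k) by rewrite -mulr_natl; ring.
rewrite lerDl; apply: sumr_ge0 => i _.
by rewrite mulrn_wge0// mulr_ge0// exprn_ge0// subr_ge0.
Qed.

Lemma expR_small : expR (2 / 25) <= 9 / 8 :> R.
Proof.
have h : 1 - 2 / 25 <= expR (- (2 / 25)) :> R by have := expR_ge1Dx (- (2 / 25) : R);
    lra.
by rewrite -[2 / 25 : R]opprK expRN invf_ple ?posrE ?expR_gt0//; lra.
Qed.

Lemma invr_onem_expR (t : R) m : 0 <= t <= 4 / 5 ->
  ((1 - t) ^+ m)^-1 <= expR (5 * t * m%:R).
Proof.
move=> /andP[t0 t1]; have p : 0 < 1 - t by lra.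
rewrite mulrC expRM_natl -exprVn lerXn2r ?nnegrE ?invr_ge0 ?expR_ge0 ?(ltW p)//.
(* For nonnegative t, (1 - t)(1 + 5 t) >= 1 holds exactly up to t = 4/5. *)
apply: (@le_trans _ _ (1 + 5 * t)); last exact: expR_ge1Dx.
by rewrite -[(1 - t)^-1]mul1r ler_pdivrMr//; nra.
Qed.

(** The odd factorial is at most a geometric term in y^D with y = D k / n, while [binomial_term_le1]
    bounds the coefficient for any t in (0, 1). Choosing t proportional to y^D cancels the powers of
    t and leaves m t / k, which the hypothesis on m makes small. *)
Lemma adv_term_le (D n m d k : nat) : (2 <= D)%N -> (0 < k)%N -> (2 * k <= d)%N ->
  (D * k <= n)%N ->
  m%:R * d%:R ^+ (D - 1) <= (50 * D%:R ^+ D)^-1 * n%:R ^+ D :> R ->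
  adv_coef R m k * (odd_fact R (D * k) / n%:R ^+ (D * k)) <= 1 / 50 * (9 / 10) ^+ k.
Proof.
move=> D2 k0 kd kn hm.
have n0 : (0 < n)%N by apply: leq_trans kn; rewrite muln_gt0 k0 andbT; exact: ltnW.
have nR : 0 < n%:R :> R by rewrite ltr0n.
have kR : 0 < k%:R :> R by rewrite ltr0n.
have DR : 0 < D%:R :> R by rewrite ltr0n ltnW.
pose y : R := (D * k)%:R / n%:R.
have y0 : 0 < y by rewrite divr_gt0// ltr0n muln_gt0 k0 andbT ltnW.
have y1 : y <= 1 by rewrite ler_pdivrMr// mul1r ler_nat.
(* [t ^- k] is absorbed by the bound on the moment, and [(1 - t) ^- m] is at
   most [(9 / 8) ^+ k] because [m t] is a small multiple of [k]. *)
pose t : R := 4 / 5 * y ^+ D.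
have yD1 : y ^+ D <= 1 by apply: exprn_ile1 => //; exact: ltW.
have t0 : 0 < t by rewrite mulr_gt0// ?exprn_gt0//; lra.
have t1 : t <= 4 / 5 by rewrite /t; lra.
(* One factor k of k^D is set aside and k^(D-1) <= d^(D-1) brings in the hypothesis; 2/125 is 4/5
   divided by 50. *)
have hmt : m%:R * t <= 2 / 125 * k%:R.
  have e : y ^+ D = D%:R ^+ D / n%:R ^+ D * (k%:R * k%:R ^+ (D - 1)).
    rewrite -(exprS k%:R (D - 1)) subn1 prednK ?(ltnW D2)// /y natrM expr_div_n exprMn.
    by rewrite mulrAC.
  have h1 : m%:R * k%:R ^+ (D - 1) <= (50 * D%:R ^+ D)^-1 * n%:R ^+ D :> R.
    apply: le_trans hm; rewrite ler_wpM2l// lerXn2r ?nnegrE// ler_nat.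
    by apply: leq_trans kd; rewrite mul2n -addnn leq_addr.
  have DD : 0 < D%:R ^+ D :> R by rewrite exprn_gt0.
  have nD : 0 < n%:R ^+ D :> R by rewrite exprn_gt0.
  rewrite /t e; move: DD nD h1; move: (D%:R ^+ D) (n%:R ^+ D) (k%:R ^+ (D - 1)) => u
      v z u0 v0 h1.
  have -> : m%:R * (4 / 5 * (u / v * (k%:R * z))) = 4 / 5 * k%:R * (u / v) * (m%:R *
      z) by ring.
  apply: (@le_trans _ _ (4 / 5 * k%:R * (u / v) * ((50 * u)^-1 * v))).
    by rewrite ler_wpM2l// mulr_ge0// ?divr_ge0 ?(ltW u0) ?(ltW v0)// mulr_ge0.
  by rewrite le_eqVlt; apply/orP; left; apply/eqP; field; rewrite !gt_eqF.
(* Since D >= 2, (4/5)^D <= (4/5)^2: one factor 4/5 is absorbed in t and the other provides the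
   decay. *)
have hO : odd_fact R (D * k) / n%:R ^+ (D * k) <= 5 / 4 * (4 / 5 * t) ^+ k.
  rewrite ler_pdivrMr ?exprn_gt0//; apply: le_trans (odd_fact_le _ _) _.
  rewrite -[leRHS]mulrA ler_wpM2l//.
  have -> : 4 / 5 * (D * k)%:R = 4 / 5 * y * n%:R :> R by rewrite /y -[RHS]mulrA
      divfK// gt_eqF.
  rewrite exprMn ler_wpM2r ?exprn_ge0// exprM lerXn2r ?nnegrE//.
  - by rewrite exprn_ge0// mulr_ge0// ltW.
  - by rewrite mulr_ge0// ltW.
  - have h : (4 / 5) ^+ D <= (4 / 5) ^+ 2 :> R by rewrite ler_wiXn2l//; lra.
    have yD0 : 0 <= y ^+ D by rewrite exprn_ge0// ltW.
    by rewrite exprMn /t; have := ler_wpM2r yD0 h; lra.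
have hB : adv_coef R m k <= m%:R / k%:R * (t / t ^+ k) * (9 / 8) ^+ k.
  have tk : t / t ^+ k = (t ^+ k.-1)^-1.
    by rewrite -[in LHS](prednK k0) exprS invfM mulrA divff ?mul1r// gt_eqF.
  have hC : 'C(m + k.-1, k.-1)%:R <= (t ^+ k.-1)^-1 * (9 / 8) ^+ k.
    have p : 0 < (1 - t) ^+ m by rewrite exprn_gt0//; lra.
    have q : 0 < t ^+ k.-1 by rewrite exprn_gt0.
    have t01 : 0 <= t <= 1 by apply/andP; split; lra.
    have := @binomial_term_le1 m k.-1 t t01.
    rewrite -ler_pdivlMr// -ler_pdivlMr// mul1r => h; apply: (le_trans h).
    rewrite mulrC ler_wpM2l ?invr_ge0 ?(ltW q)//.
    apply: le_trans (invr_onem_expR m _) _; first by apply/andP; split; lra.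
    apply: (@le_trans _ _ (expR (2 / 25 * k%:R))).
      by rewrite ler_expR; lra.
    rewrite expRM_natr lerXn2r ?nnegrE ?expR_ge0 ?expR_small//; lra.
  rewrite tk -mulrA -{1 2}(prednK k0); apply: le_trans (adv_coefS_le _ _) _.
  by rewrite ler_wpM2l// divr_ge0.
apply: (@le_trans _ _ (m%:R / k%:R * (t / t ^+ k) * (9 / 8) ^+ k * (5 / 4 * (4 / 5 *
    t) ^+ k))).
  apply: ler_pM => //; first exact: adv_coef_ge0.
  by rewrite divr_ge0 ?odd_fact_ge0// exprn_ge0.
have -> : m%:R / k%:R * (t / t ^+ k) * (9 / 8) ^+ k * (5 / 4 * (4 / 5 * t) ^+ k) =
    5 / 4 * (m%:R * t / k%:R) * (9 / 10) ^+ k.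
  (* The ratio 9/8 lost on the coefficient is compensated by the 4/5 gained on the moment. *)
  have -> : (9 / 10 : R) = 9 / 8 * (4 / 5) by lra.
  rewrite (exprMn k (4 / 5) t) (exprMn k (9 / 8) (4 / 5));
      have : t ^+ k != 0 by rewrite expf_neq0// gt_eqF.
  move: (t ^+ k) ((4 / 5) ^+ k) ((9 / 8) ^+ k) => T A B T0.
  by field; rewrite T0 gt_eqF.
apply: ler_wpM2r; first by rewrite exprn_ge0//; lra.
have : m%:R * t / k%:R <= 2 / 125 by rewrite ler_pdivrMr.
by move: (_ / k%:R) => z; lra.
Qed.
End AdvantageSeries.

(** * The planted distribution *)

Section Mixture.
Context d (T : measurableType d) (R : realType) (I : finType) (i0 : I).
Variable nu : I -> probability T R.

Definition mixture_weight : {nonneg R} := (#|I|%:R^-1)%:nng.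

Local Open Scope ereal_scope.

(** [msum] is indexed by natural numbers, hence the enumeration of I. The point [i0] is a default
    that [nth] never returns out of range, and it witnesses that I is nonempty. *)
Definition mixture : set T -> \bar R :=
  mscale mixture_weight
    (msum (fun k => nu (nth i0 (enum I) k)) #|I|).

HB.instance Definition _ := Measure.on mixture.

Lemma sum_nth_enum (F : I -> \bar R) :
  \sum_(k < #|I|) F (nth i0 (enum I) k) = \sum_i F i.
Proof.
by rewrite -[RHS]big_enum (big_nth i0) -cardE big_mkord.
Qed.

Let card_neq0 : (#|I|%:R != 0 :> R)%R.
Proof. by rewrite pnatr_eq0 -lt0n; apply/card_gt0P; exists i0. Qed.

Lemma mixtureE A : mixture A = (#|I|%:R^-1)%R%:E * \sum_i nu i A.
Proof. by rewrite -sum_nth_enum. Qed.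

Lemma mixture_setT : mixture [set: T] = 1.
Proof.
rewrite mixtureE (eq_bigr (fun=> 1%:E)) => [|i _]; last exact: probability_setT.
by rewrite sumEFin sumr_const -EFinM mulVf.
Qed.

HB.instance Definition _ := Measure_isProbability.Build _ _ _ mixture mixture_setT.

Lemma ge0_integral_mixture (f : T -> \bar R) :
  measurable_fun [set: T] f -> (forall x, 0 <= f x) ->
  \int[mixture]_x f x = (#|I|%:R^-1)%R%:E * \sum_i \int[nu i]_x f x.
Proof.
move=> mf f0; rewrite ge0_integral_mscale// ge0_integral_measure_sum//.
by rewrite (sum_nth_enum (fun i => \int[nu i]_x f x)).
Qed.

Lemma integrable_mixture (f : T -> \bar R) :
  (forall i, (nu i).-integrable [set: T] f) -> mixture.-integrable [set: T] f.
Proof.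
move=> fi; have mf := measurable_int _ (fi i0); apply/integrableP; split => //.
rewrite ge0_integral_mixture//; last exact: measurableT_comp.
rewrite lte_mul_pinfty ?lee_fin//.
by apply: lte_sum_pinfty => i _; have /integrableP[] := fi i.
Qed.

Lemma integral_mixture (f : T -> \bar R) :
  (forall i, (nu i).-integrable [set: T] f) ->
  \int[mixture]_x f x = (#|I|%:R^-1)%R%:E * \sum_i \int[nu i]_x f x.
Proof.
move=> fi; have mf := measurable_int _ (fi i0).
rewrite integralE !ge0_integral_mixture//; last 2 first.
- exact: measurable_funeneg.
- exact: measurable_funepos.
have fp i := integrable_fin_num measurableT (integrable_funepos measurableT (fi i)).
have fn i := integrable_fin_num measurableT (integrable_funeneg measurableT (fi i)).
rewrite (eq_bigr _ (fun i _ => esym (fineK (fp i)))).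
rewrite (eq_bigr _ (fun i _ => esym (fineK (fn i)))).
rewrite [X in _ = _ * X](eq_bigr (fun i => (fine (\int[nu i]_x f^\+ x) - fine
    (\int[nu i]_x f^\- x))%:E)).
  by rewrite !sumEFin -!EFinM -EFinB sumrB mulrBr.
by move=> i _; rewrite integralE EFinB (fineK (fp i)) (fineK (fn i)).
Qed.

End Mixture.

(** * Polynomial images of the Gaussian vector *)

Section PolynomialMap.
Variables (R : realType) (K : nat).

Lemma measurable_poly_fun (f : mpoly.mpoly K R) :
  measurable_fun [set: vect R K] (poly_fun f).
Proof. by apply/measurable_EFinP; exact: measurable_int (integrable_poly_fun f). Qed.

Variable t : K.-tuple (mpoly.mpoly K R).

Definition poly_map (v : vect R K) : vect R K := [tuple poly_fun (tnth t k) v | k < K].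

Lemma measurable_poly_map : measurable_fun [set: vect R K] poly_map.
Proof.
apply/measurable_fun_tnthP => i.
rewrite (_ : _ \o _ = poly_fun (tnth t i)); first exact: measurable_poly_fun.
by apply/funext => v /=; rewrite tnth_mktuple.
Qed.

HB.instance Definition _ :=
  isMeasurableFun.Build _ _ _ _ poly_map measurable_poly_map.

Lemma poly_fun_comp (f : mpoly.mpoly K R) (v : vect R K) :
  poly_fun f (poly_map v) = poly_fun (mpoly.comp_mpoly t f) v.
Proof.
rewrite /poly_fun mpoly.comp_mpoly_meval; apply: mpoly.meval_eq => i.
by rewrite tnth_mktuple.
Qed.

Definition gauss_image : probability (vect R K) R := distribution (std_gaussian R K)
    poly_map.

Lemma integrable_gauss_image f :
  gauss_image.-integrable [set: vect R K] (EFin \o poly_fun f).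
Proof.
have i : (std_gaussian R K).-integrable [set: vect R K] ((EFin \o poly_fun f) \o
    poly_map).
  rewrite (_ : _ \o _ = EFin \o poly_fun (mpoly.comp_mpoly t f)).
    exact: integrable_poly_fun.
  by apply/funext => v /=; rewrite poly_fun_comp.
have mf : measurable_fun [set: vect R K] (EFin \o poly_fun f).
  by apply/measurable_EFinP; exact: measurable_poly_fun.
exact: (integrable_pushforward measurable_poly_map mf i measurableT).
Qed.

Lemma integral_gauss_image f :
  (\int[gauss_image]_v (poly_fun f v)%:E = (gauss_exp (mpoly.comp_mpoly t f))%:E)%E.
Proof.
have e : (EFin \o poly_fun f) \o poly_map = EFin \o poly_fun (mpoly.comp_mpoly t f).
  by apply/funext => v /=; rewrite poly_fun_comp.
have mf : measurable_fun [set: vect R K] (EFin \o poly_fun f).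
  by apply/measurable_EFinP; exact: measurable_poly_fun.
rewrite -expectation_poly_fun unlock.
have i : (std_gaussian R K).-integrable [set: vect R K] ((EFin \o poly_fun f) \o
    poly_map).
  by rewrite e; exact: integrable_poly_fun.
transitivity (\int[std_gaussian R K]_v ((EFin \o poly_fun f) \o poly_map) v)%E.
  exact: (integral_pushforward measurable_poly_map mf i).
by rewrite e.
Qed.

End PolynomialMap.

(** * Advantage against a mixture of projected Gaussians *)

Section PlantedDistribution.
Variables (R : realType) (K m : nat) (I : finType) (i0 : I).
Variables (W : I -> 'I_m -> 'I_K -> R) (rho : I -> I -> R).
Hypothesis dotW : forall s s' i j, dot (W s i) (W s' j) = rho s s' *+ (i == j).
Hypothesis rho1 : forall s, rho s s = 1.

Definition planted : probability (vect R K) R :=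
  mixture i0 (fun s => gauss_image (proj_tuple (W s))).

Lemma planted_finite_moments d : finite_moments d planted.
Proof. by move=> f _; apply: integrable_mixture => s;
    exact: integrable_gauss_image. Qed.

Lemma expectation_planted f : ('E_planted[poly_fun f] =
  (#|I|%:R^-1 * \sum_s gauss_exp (proj_comp (W s) f))%:E)%E.
Proof.
rewrite unlock integral_mixture; last by move=> s; exact: integrable_gauss_image.
by under eq_bigr do rewrite integral_gauss_image; rewrite sumEFin EFinM.
Qed.

(** The planted expectation of f is its Gaussian expectation against the average L of the
    likelihoods. Cauchy-Schwarz bounds its square by the squared norm of L, expanded over pairs. *)
Lemma planted_advantage d f : deg_le d f -> gauss_exp (f ^+ 2) = 1 ->
  (#|I|%:R^-1 * \sum_s gauss_exp (proj_comp (W s) f)) ^+ 2 <=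
  (#|I|%:R^-1) ^+ 2 * \sum_s \sum_s' \sum_(k < d./2.+1) adv_coef R m k * rho s s' ^+
      (2 * k).
Proof.
move=> df f1; pose L := #|I|%:R^-1 *: \sum_s likelihood (W s) d./2.
have orth s i j : dot (W s i) (W s j) = (i == j)%:R by rewrite dotW rho1.
have -> : #|I|%:R^-1 * \sum_s gauss_exp (proj_comp (W s) f) = gauss_exp (f * L).
  rewrite -scalerAr linearZ/=; congr (_ * _); rewrite mulr_sumr linear_sum.
  apply: eq_bigr => s _; apply: gauss_exp_proj_comp => //.
  (* Truncation at half of d, rounded down, suffices: d <= 2 (d/2) + 1 in both parities. *)
  apply: deg_ltW (@deg_lt_msize _ _ f); apply: leq_trans df _.
  by rewrite mul2n -[X in (X < _)%N]odd_double_half ltnS; case: odd.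
apply: (le_trans (gauss_exp_CauchySchwarz L f1)).
rewrite le_eqVlt; apply/orP; left; apply/eqP.
rewrite expr2 -scalerAl -scalerAr !linearZ/= mulrA -expr2; congr (_ * _).
rewrite mulr_suml linear_sum; apply: eq_bigr => s _.
rewrite mulr_sumr linear_sum; apply: eq_bigr => s' _.
by rewrite /= (gauss_exp_likelihood2 _ (dotW s s')).
Qed.

Lemma planted_fails d :
  (#|I|%:R^-1) ^+ 2 * \sum_s \sum_s' \sum_(k < d./2.+1) adv_coef R m k * rho s s' ^+
      (2 * k) < 4 ->
  fails_to_distinguish d (1 / 2) (std_gaussian R K) planted.
Proof.
move=> h [f [df f1]]; rewrite expectation_planted lee_fin => hf.
have f2 : gauss_exp (f ^+ 2) = 1.
  apply: EFin_inj; rewrite -expectation_poly_fun -[RHS]f1.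
  by congr expectation; apply/funext => v; rewrite /poly_fun expr2 mpoly.mevalM.
have := le_lt_trans (planted_advantage df f2) h.
have e : (1 / 2)^-1 = 2 :> R by rewrite invf_div divr1.
by rewrite e in hf; move: hf; move: (_ * _) => x hx; nra.
Qed.
End PlantedDistribution.

(** * Systems planted at the points of a scaled hypercube *)

Section PlantedSystems.
Variables (R : realType) (D n m : nat).
Local Notation K := #|{: coords D n m}|.
Local Notation signs := {ffun 'I_n -> bool}.

(** Applied to products of coordinates, this turns the inner product of the D-th tensor powers of x
    and y into <x, y>^D. *)
Lemma sum_tuple_prod (F : 'I_n -> R) :
  \sum_(a : D.-tuple 'I_n) \prod_(l < D) F (tnth a l) = (\sum_j F j) ^+ D.
Proof.
rewrite -[X in _ ^+ X]card_ord -prodr_const bigA_distr_bigA/=.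
rewrite (reindex (@finfun_of_tuple 'I_n D)).
  by apply: eq_bigr => a _; apply: eq_bigr => l _; rewrite ffunE.
by exists (@tuple_of_finfun 'I_n D) => a _;
    [exact: finfun_of_tupleK|exact: tuple_of_finfunK].
Qed.

Lemma sum_coords (F : 'I_K -> R) : \sum_k F k =
  \sum_i \sum_(a : D.-tuple 'I_n) F (enum_rank (inl (i, a) : coords D n m)) +
  \sum_i F (enum_rank (inr i : coords D n m)).
Proof.
rewrite (reindex enum_rank) /=; last by apply: onW_bij; exact: enum_rank_bij.
rewrite big_sumType/=; congr (_ + _).
by rewrite pair_bigA; apply: eq_bigr => -[].
Qed.

Variable t : R.
Implicit Types s : signs.

Definition sign_point s : 'rV[R]_n := \row_j (t * rsign R (s j)).

(** The squared norm of the D-th tensor power of a sign point extended by -1; it is the same at all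
    sign points. *)
Definition equation_sqnorm : R := 1 + (t ^+ 2 * n%:R) ^+ D.

Definition equation_vec s (i : 'I_m) (k : 'I_K) : R :=
  match enum_val k with
  | inl (i', a) => (\prod_(l < D) sign_point s 0 (tnth a l)) *+ (i' == i)
  | inr i' => - (i' == i)%:R
  end / Num.sqrt equation_sqnorm.

Definition sign_overlap s s' : R :=
  ((t ^+ 2 * \sum_j rsign R (s' j) * rsign R (s j)) ^+ D + 1) / equation_sqnorm.

Lemma equation_sqnorm_gt0 : 0 < equation_sqnorm.
Proof. by rewrite ltr_pwDl// exprn_ge0// mulr_ge0// sqr_ge0. Qed.

Lemma equation_vecE s i (v : 'I_K -> R) : dot (equation_vec s i) v =
  (\sum_a (\prod_(l < D) sign_point s 0 (tnth a l)) * v (enum_rank (inl (i, a) :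
      coords D n m))
   - v (enum_rank (inr i : coords D n m))) / Num.sqrt equation_sqnorm.
Proof.
rewrite /dot sum_coords mulrBl; congr (_ + _).
  rewrite (bigD1 i)//= [X in _ + X]big1 ?addr0 => [|i' ii'].
    rewrite mulr_suml; apply: eq_bigr => a _.
    by rewrite /equation_vec enum_rankK eqxx mulr1n mulrAC.
  by rewrite big1// => a _; rewrite /equation_vec enum_rankK (negbTE ii') mulr0n !mul0r.
rewrite (bigD1 i)//= big1 ?addr0 => [|i' ii'].
  by rewrite /equation_vec enum_rankK eqxx mulN1r mulNr mulrC.
by rewrite /equation_vec enum_rankK (negbTE ii') oppr0 !mul0r.
Qed.

Lemma dot_equation_vec s s' i j :
  dot (equation_vec s i) (equation_vec s' j) = sign_overlap s s' *+ (i == j).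
Proof.
rewrite equation_vecE.
under eq_bigr => a _ do rewrite {1}/equation_vec enum_rankK.
rewrite /equation_vec enum_rankK; case: eqVneq => [_|_]; last first.
  rewrite big1 => [|a _]; last by rewrite !mulr0n mul0r mulr0.
  by rewrite !mulr0n oppr0 mul0r subr0 mul0r.
rewrite !mulr1n /sign_overlap.
under eq_bigr => a _ do rewrite mulr1n mulrA -big_split/=.
rewrite -mulr_suml (sum_tuple_prod (fun j => sign_point s 0 j * sign_point s' 0 j)).
rewrite mulNr opprK -mulrDl -mulrA -invfM -expr2 sqr_sqrtr ?ltW ?equation_sqnorm_gt0//.
congr ((_ ^+ _ + _) / _); rewrite mulr_sumr; apply: eq_bigr => l _.
by rewrite !mxE; ring.
Qed.

Lemma sign_overlap1 s : sign_overlap s s = 1.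
Proof.
rewrite /sign_overlap (eq_bigr (fun=> 1)) => [|j _]; last by rewrite -expr2 rsign_sqr.
by rewrite sumr_const card_ord addrC divff// gt_eqF ?equation_sqnorm_gt0.
Qed.

Definition sign0 : signs := [ffun=> false].

Definition planted_system : probability (system R D n m) R := planted sign0
    equation_vec.

Definition solved_by (x : 'rV[R]_n) : set (system R D n m) :=
  [set z | forall i, lhs z i x = rhs z i].

Lemma measurable_solved_by x : measurable (solved_by x).
Proof.
rewrite (_ : solved_by x = \bigcap_(i in [set: 'I_m])
    ((fun z => lhs z i x - rhs z i) @^-1` [set 0])).
  apply: fin_bigcap_measurable => // i _; rewrite -[X in measurable X]setTI.
  suff mf : measurable_fun [set: system R D n m] (fun z => lhs z i x - rhs z i).
    exact: mf.
  apply: measurable_funB; last exact: measurable_tnth.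
  apply: measurable_sum => a; apply: measurable_funM => //; exact: measurable_tnth.
apply/seteqP; split => z /= h i; first by move=> _; rewrite /= h subrr.
by have := h i I => /subr0_eq.
Qed.

(** Orthogonality to [equation_vec s i] is, up to the positive normalization, the i-th equation at
    [sign_point s]. *)
Lemma proj_tuple_solved s (v : system R D n m) :
  solved_by (sign_point s) (poly_map (proj_tuple (equation_vec s)) v).
Proof.
move=> i; set z := poly_map _ _.
have zE k : tnth z k = tnth v k - \sum_i equation_vec s i k * dot (equation_vec s i)
    (tnth v).
  rewrite tnth_mktuple /poly_fun tnth_mktuple mpoly.mevalB mpoly.mevalXU (raddf_sum
      (mpoly.meval (tnth v))); congr (_ - _).
  apply: eq_bigr => j _; rewrite /= mpoly.mevalZ /linform (raddf_sum (mpoly.meval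
      (tnth v))); congr (_ * _).
  by apply: eq_bigr => l _; rewrite /= mpoly.mevalZ mpoly.mevalXU.
have z0 : dot (equation_vec s i) (tnth z) = 0.
  rewrite /dot; under eq_bigr => k _ do rewrite zE mulrBr mulr_sumr.
  rewrite sumrB exchange_big/= (bigD1 i)//= [X in _ - (_ + X)]big1 => [|j ji].
    under [X in _ - (X + _)]eq_bigr do rewrite mulrA.
    rewrite -mulr_suml -/(dot (equation_vec s i) (equation_vec s i)).
    by rewrite dot_equation_vec sign_overlap1 eqxx mul1r addr0 subrr.
  under eq_bigr do rewrite mulrA.
  rewrite -mulr_suml -/(dot (equation_vec s i) (equation_vec s j)).
  by rewrite dot_equation_vec eq_sym (negbTE ji) mulr0n mul0r.
move: z0; rewrite equation_vecE => /eqP; rewrite mulf_eq0 invr_eq0 sqrtr_eq0.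
rewrite leNgt equation_sqnorm_gt0 orbF => /eqP/subr0_eq h.
by rewrite /rhs -h; apply: eq_bigr => a _; rewrite mulrC.
Qed.

(** It suffices to exhibit a measurable null set containing the unsolvable systems: the complement
    of the finite union of the [solved_by] sets. It is null since each component of the mixture is
    solved by its own sign point. *)
Lemma planted_system_solvable : {ae planted_system, forall z, solvable z}.
Proof.
pose B := \bigcup_(s in [set: signs]) solved_by (sign_point s).
have mB : measurable B.
  by apply: fin_bigcup_measurable => // s _; exact: measurable_solved_by.
exists (~` B); split.
- exact: measurableC.
- have -> : planted_system (~` B) =
      mixture sign0 (fun s => gauss_image (proj_tuple (equation_vec s))) (~` B) by [].
  rewrite mixtureE big1 ?mule0// => s _.
  transitivity (std_gaussian R K (poly_map (proj_tuple (equation_vec s)) @^-1` ~` B))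
      => //.
  rewrite (_ : _ @^-1` _ = set0) ?measure0//.
  apply/seteqP; split => // v /=; apply; exists s => //; exact: proj_tuple_solved.
- apply: subsetC => z [s _ h]; by exists (sign_point s).
Qed.

End PlantedSystems.

(** * Moments of the overlap and choice of the scale *)

Section OverlapMoments.
Variable R : realType.

(** Used with a the D-th power of the normalized correlation of two sign vectors and e the
    contribution of the right-hand side coordinate. The error is linear in e, so a large scale
    removes it. *)
Lemma perturbed_pow_le (a e : R) k : `|a| <= 1 -> 0 <= e ->
  ((a + e) / (1 + e)) ^+ (2 * k) <= a ^+ (2 * k) + (2 * k)%:R * e.
Proof.
move=> a1 e0; have p : 0 < 1 + e by rewrite ltr_pwDl.
pose v := (`|a| + e) / (1 + e).
have v0 : 0 <= v by rewrite divr_ge0 ?addr_ge0// ltW.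
have v1 : v <= 1 by rewrite ler_pdivrMr// mul1r lerD2r.
have va : v <= `|a| + e by rewrite ler_pdivrMr// ler_peMr ?addr_ge0// lerDl.
have h j : v ^+ j <= `|a| ^+ j + j%:R * e.
  elim: j => [|j IH]; first by rewrite !expr0 mul0r addr0.
  have aj0 : 0 <= `|a| ^+ j by rewrite exprn_ge0.
  have aj1 : `|a| ^+ j <= 1 by rewrite exprn_ile1.
  have je0 : 0 <= j%:R * e by rewrite mulr_ge0.
  rewrite !exprS -natr1 mulrDl mul1r.
  apply: (le_trans (ler_wpM2l v0 IH)); rewrite mulrDr.
  have h1 : v * `|a| ^+ j <= (`|a| + e) * `|a| ^+ j by rewrite ler_wpM2r.
  have h2 : v * (j%:R * e) <= j%:R * e by rewrite ler_piMl.
  have h3 : e * `|a| ^+ j <= e by rewrite ler_piMr.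
  by move: h1 h2 h3; rewrite mulrDl; lra.
have e2 (x : R) : x ^+ (2 * k) = `|x| ^+ (2 * k) by rewrite !exprM real_normK ?num_real.
rewrite e2 [X in _ <= X + _]e2; apply: le_trans (h _).
rewrite lerXn2r ?nnegrE// normrM [X in _ * X]ger0_norm ?invr_ge0 ?(ltW p)//.
by rewrite ler_wpM2r ?invr_ge0 ?(ltW p)// (le_trans (ler_normD _ _))// (ger0_norm e0).
Qed.

(** For fixed s', the correlation with s is a Rademacher sum with coefficients of square 1, so
    Khintchine gives (2 D k - 1)!! n^(D k). The perturbation is 1/M, at most 1/t. *)
Lemma sum_overlap_pow_le (D n : nat) (t : R) k : (0 < n)%N -> (0 < D)%N -> 1 <= t ->
  \sum_(s : {ffun 'I_n -> bool}) \sum_s' sign_overlap D t s s' ^+ (2 * k) <=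
  #|{ffun 'I_n -> bool}|%:R ^+ 2 *
    (odd_fact R (D * k) / n%:R ^+ (D * k) + (2 * k)%:R / t).
Proof.
move=> n0 D0 t1; have nR : 0 < n%:R :> R by rewrite ltr0n.
have t0 : 0 < t by lra.
set N := #|_|%:R.
pose M := (t ^+ 2 * n%:R) ^+ D.
have tn : t <= t ^+ 2 * n%:R.
  rewrite expr2 -mulrA ler_peMr ?(ltW t0)//.
  by apply: (le_trans t1); rewrite ler_peMr ?(ltW t0)// ler1n.
have tM : t <= M.
  apply: (le_trans tn); rewrite /M -[leLHS]expr1 ler_weXn2l//; lra.
have M0 : 0 < M by lra.
have eM : M^-1 <= t^-1 by rewrite lef_pV2.
pose S (s s' : {ffun 'I_n -> bool}) : R := rademacher_sum (fun j => rsign R (s' j)) s.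
have rhoE s s' : sign_overlap D t s s' = ((S s s' / n%:R) ^+ D + M^-1) / (1 + M^-1).
  rewrite /sign_overlap /equation_sqnorm -/M -[\sum_j _]/(S s s').
  have -> : (t ^+ 2 * S s s') ^+ D = (S s s' / n%:R) ^+ D * M.
    by rewrite /M -exprMn; congr (_ ^+ _); field; rewrite gt_eqF.
  by field; rewrite !gt_eqF//; lra.
have S1 s s' : `|(S s s' / n%:R) ^+ D| <= 1.
  rewrite normrX exprn_ile1// normf_div (ger0_norm (ltW nR)) ler_pdivrMr// mul1r.
  apply: le_trans (ler_norm_sum _ _ _) _.
  rewrite -[X in _ <= X%:R]card_ord -sumr_const; apply: ler_sum => j _.
  by rewrite /rsign normrM !normr_sign mulr1.
rewrite exchange_big/=.
have step (s' : {ffun 'I_n -> bool}) : \sum_s sign_overlap D t s s' ^+ (2 * k) <=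
    N * (odd_fact R (D * k) / n%:R ^+ (D * k) + (2 * k)%:R / t).
  apply: (@le_trans _ _ (\sum_s (S s s' ^+ (2 * (D * k)) / n%:R ^+ (2 * (D * k)) + (2
      * k)%:R / t))).
    apply: ler_sum => s _; rewrite rhoE.
    apply: le_trans (perturbed_pow_le k (S1 s s') _) _; first by rewrite invr_ge0 ltW.
    apply: lerD; last by rewrite ler_wpM2l.
    by rewrite -exprM mulnCA expr_div_n.
  rewrite big_split/= sumr_const -[X in _ + X <= _]mulr_natl -/N mulrDr lerD2r
      -mulr_suml.
  rewrite ler_pdivrMr ?exprn_gt0//.
  apply: le_trans (khintchine _ _) _.
  rewrite (eq_bigr (fun=> 1)) => [|j _]; last exact: rsign_sqr.
  rewrite sumr_const card_ord /N card_ffun card_bool card_ord natrX mul2n -addnn exprD.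
  rewrite le_eqVlt; apply/orP; left; apply/eqP; field.
  by rewrite expf_neq0// gt_eqF.
apply: le_trans (ler_sum _ (fun s' _ => step s')) _.
by rewrite sumr_const -[leLHS]mulr_natl expr2 mulrA.
Qed.

Lemma sum_geometric_le N : \sum_(k < N) (9 / 10 : R) ^+ k <= 10.
Proof.
suff -> : \sum_(k < N) (9 / 10 : R) ^+ k = 10 - 10 * (9 / 10) ^+ N.
  by rewrite gerBl mulr_ge0// exprn_ge0//; lra.
elim: N => [|N IH]; first by rewrite big_ord0 expr0; lra.
by rewrite big_ord_recr/= IH exprS; lra.
Qed.

(** The term k = 0 gives 1, the moment bounds give a geometric series of sum at most 1/5, and the
    perturbation errors total at most 1. *)
Lemma exists_large_scale (D n m d : nat) : (2 <= D)%N ->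
  d%:R <= 2 * n%:R / D%:R :> R ->
  m%:R * d%:R ^+ (D - 1) <= (50 * D%:R ^+ D)^-1 * n%:R ^+ D :> R ->
  exists2 t : R, 0 < t &
  (#|{ffun 'I_n -> bool}|%:R^-1) ^+ 2 * \sum_(s : {ffun 'I_n -> bool}) \sum_s'
    \sum_(k < d./2.+1) adv_coef R m k * sign_overlap D t s s' ^+ (2 * k) < 4.
Proof.
move=> D2 hd hm.
have D0 : (0 < D)%N by exact: ltnW.
have dn : (D * d <= 2 * n)%N.
  by rewrite -(ler_nat R) !natrM mulrC -ler_pdivlMr// ltr0n.
pose B := \sum_(k < d./2.+1) adv_coef R m k * (2 * k)%:R.
have B0 : 0 <= B by apply: sumr_ge0 => k _; rewrite mulr_ge0// adv_coef_ge0.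
(* B collects the coefficients of 1/t in the perturbation errors, so that B / t <= 1. *)
pose t := 1 + B.
have t1 : 1 <= t by rewrite lerDl.
have t0 : 0 < t by lra.
exists t => //.
set N := #|_|%:R.
have N0 : 0 < N by rewrite ltr0n; apply/card_gt0P; exists [ffun=> false].
have term (k : 'I_d./2.+1) : \sum_(s : {ffun 'I_n -> bool}) \sum_s'
    adv_coef R m k * sign_overlap D t s s' ^+ (2 * k) <=
    N ^+ 2 * ((k == 0%N :> nat)%:R + 1 / 50 * (9 / 10) ^+ k + adv_coef R m k * (2 *
        k)%:R / t).
  under eq_bigr do rewrite -mulr_sumr.
  (* The case k = 0 is separate since n may then be 0; for k > 0, D k <= n forces n > 0. *)
  rewrite -mulr_sumr; case: (posnP k) => [->|k0].
    rewrite muln0 /adv_coef big_ord0 mul1r !mulr0 mul0r addr0 expr0 mulr1.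
    rewrite (eq_bigr (fun=> N)) => [|s _]; last first.
      by under eq_bigr do rewrite expr0; rewrite sumr_const.
    rewrite mul1r sumr_const -[N *+ _]mulr_natl -/N -expr2 mulrDr -[X in X <= _]mulr1
        lerDl.
    by rewrite mulr_ge0 ?sqr_ge0.
  have kd : (2 * k <= d)%N.
    by rewrite mul2n (leq_trans _ (leq_subr (odd d) d))// -[d in (d -
        _)%N]odd_double_half addKn leq_double -ltnS.
  have kn : (D * k <= n)%N.
    by rewrite -(leq_pmul2l (isT : (0 < 2)%N)) (leq_trans _ dn)// mulnCA leq_mul2l kd
        orbT.
  have n0 : (0 < n)%N by apply: leq_trans kn; rewrite muln_gt0 D0.
  apply: le_trans (ler_wpM2l (adv_coef_ge0 _ _ _) (sum_overlap_pow_le k n0 D0 t1)) _.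
  rewrite -/N mulrCA ler_wpM2l ?sqr_ge0// (_ : false%:R = 0)// add0r mulrDr.
  by apply: lerD; [exact: adv_term_le D2 k0 kd kn hm | rewrite mulrA].
under eq_bigr do rewrite exchange_big.
rewrite exchange_big/=.
apply: (@le_lt_trans _ _ (1 + 1 / 50 * 10 + 1)); last by lra.
rewrite exprVn ler_pdivrMl ?exprn_gt0//.
apply: le_trans (ler_sum _ (fun k _ => term k)) _.
rewrite -mulr_sumr ler_wpM2l ?sqr_ge0// !big_split/=.
apply: lerD; [apply: lerD|].
- by rewrite big_ord_recl big1 ?addr0.
- by rewrite -mulr_sumr ler_wpM2l ?sum_geometric_le.
- by rewrite -mulr_suml ler_pdivrMr// mul1r /t lerDr.
Qed.
End OverlapMoments.

Theorem theorem4p1 (R : realType) (D : nat) (hD : (2 <= D)%N) :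
  exists c : R, 0 < c /\
    forall d n m : nat,
      d%:R <= 2 * n%:R / D%:R :> R ->
      m%:R * d%:R ^+ (D - 1) <= c * n%:R ^+ D :> R ->
      exists nuP : probability (system R D n m) R,
        [/\ {ae nuP, forall s, solvable s},
            finite_moments d nuP
          & fails_to_distinguish d (1 / 2) (random_system R D n m) nuP].
Proof.
(* This is the constant for which [adv_term_le] holds. *)
exists (50 * D%:R ^+ D)^-1; split.
  by rewrite invr_gt0 mulr_gt0// exprn_gt0// ltr0n ltnW.
move=> d n m hd hm; have [t t0 ht] := exists_large_scale hD hd hm.
exists (planted_system D n m t); split.
- exact: planted_system_solvable.
- exact: planted_finite_moments.
- apply: planted_fails ht => [s s' i j|s]; first exact: dot_equation_vec.
  exact: sign_overlap1.
Qed.
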